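(* Let $\Omega$ be a finite state space with $d=|\Omega|$, let $P=[p(u,v)]_{u,v\in\Omega}$ be an irreducible reversible transition matrix on $\Omega$ with invariant distribution $\mu$, and let $\nu$ be a probability distribution on $\Omega$. Let $\tilde\Omega^2$ be the symmetric length-2 path space, $\{\tilde u_k\}_{k\ge1}$ the Markov chain on $\tilde\Omega^2$ with transition matrix $\tilde P_2$ and initial state generated from $\nu$, and $H_n=\frac1n\sum_{k=1}^n\tilde F(\tilde u_k)$, all as defined in the context. Then: (1) $\{\tilde u_k\}_{k\ge1}$ is a reversible Markov chain (its transition matrix $\tilde P_2$ satisfies detailed balance with respect to $\tilde\mu_2$), $H_n$ is a symmetric matrix, and $H_n$ converges to $D_\mu P$ almost surely as $n\to\infty$. (2) For every $n\in\mathbb{N}_+$ and every $t>0$, $$\mathbb{P}\left\{\|H_n-D_\mu P\|\ge t\right\}\le2\|\nu/\mu\|_\infty\,d^{\,2-\frac{\pi}{4}}\exp\left(\frac{-n\,\eta(P)\,t^2}{128\pi^{-2}(2-\eta(P)/2)+1024\pi^{-3}t}\right),$$ where $\|\cdot\|$ is the $\ell_2$ operator norm. (3) For every $n\in\mathbb{N}_+$, $$\mathbb{E}\left[\|H_n-D_\mu P\|_{\mathrm F}^2\right]\le\|\nu/\mu\|_\infty\,\frac{4-\eta(P)}{n\,\eta(P)}.$$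
   Context: $d\ge2$. Reversible means $\mu(u)p(u,v)=\mu(v)p(v,u)$ for all $u,v$. $D_\mu$ is the diagonal matrix with diagonal $\mu$; $\|\cdot\|_{\mathrm F}$ is the Frobenius norm; $\|\nu/\mu\|_\infty=\max_u\nu(u)/\mu(u)$. $P$ acts on functions by $Ph(u)=\sum_v p(u,v)h(v)$. With $\langle f,g\rangle_\mu=\sum_u\mu(u)f(u)g(u)$, $\|\cdot\|_\mu$ the associated norm, and $L^0_{2,\mu}=\{h:\Omega\to\mathbb{R}:\sum_u\mu(u)h(u)=0\}$, the spectral gap is $\eta(P)=1-\sup_{0\ne h\in L^0_{2,\mu}}\langle h,Ph\rangle_\mu/\|h\|_\mu^2$. $\tilde\Omega^2$ is the quotient of $\Omega^2$ by $(u_1,u_2)\sim(u_2,u_1)$, with classes written $\widetilde{(u_1,u_2)}$. It carries the distribution $\tilde\mu_2(\tilde u)=\sum_{(u_1,u_2)\in\tilde u}\mu(u_1)p(u_1,u_2)$. The transition matrix $\tilde P_2$ on $\tilde\Omega^2$ is: from $\widetilde{(u_1,u_2)}$, choose $(w_1,w_2)$ to be $(u_1,u_2)$ or $(u_2,u_1)$ with probability $1/2$ each, then draw $v\in\Omega$ with probability $p(w_2,v)$ and jump to $\widetilde{(w_2,v)}$. The chain $\{\tilde u_k\}$ has transition matrix $\tilde P_2$ and initial state $\tilde u_1=\widetilde{(u,v)}$ where $u\sim\nu$ and then $v\sim p(u,\cdot)$. The function $\tilde F$ is $\tilde F(\widetilde{(w_1,w_2)})=\frac12(E_{w_1w_2}+E_{w_2w_1})$,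 where $E_{uv}$ is the $\Omega\times\Omega$ matrix with entry $1$ at $(u,v)$ and $0$ elsewhere. *)

(* Defs.v *)
From HB Require Import structures.
From mathcomp Require Import all_boot all_order all_algebra.
From mathcomp Require Import generic_quotient.
From mathcomp Require Import all_classical all_reals all_analysis.

Set Implicit Arguments.
Unset Strict Implicit.
Unset Printing Implicit Defensive.

Import Order.TTheory GRing.Theory Num.Theory.
Import numFieldNormedType.Exports.

Local Open Scope classical_set_scope.
Local Open Scope ring_scope.
Local Open Scope quotient_scope.

(* Distributions and transition matrices on a finite state space S are
   functions S -> R and S -> S -> R.  An S x S matrix in the linear algebra
   sense is a 'M[R]_#|S|, whose rows and columns are indexed by S through
   enum_rank / enum_val. *)

Section FiniteChains.
Context {R : realType} {S : finType}.
Implicit Types (mu nu : S -> R) (p : S -> S -> R) (h : S -> R).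

Definition distribution_on mu : Prop :=
  (forall u, 0 <= mu u) /\ \sum_u mu u = 1.

Definition transition_matrix p : Prop := forall u, distribution_on (p u).

Definition mx_of p : 'M[R]_#|S| :=
  \matrix_(i, j) p (enum_val i) (enum_val j).

Definition irreducible_chain p : Prop :=
  forall u v, exists n : nat, 0 < (mx_of p ^+ n) (enum_rank u) (enum_rank v).

Definition invariant_measure mu p : Prop :=
  forall v, \sum_u mu u * p u v = mu v.

Definition reversible mu p : Prop :=
  forall u v, mu u * p u v = mu v * p v u.

Definition dmx_of mu : 'M[R]_#|S| := diag_mx (\row_i mu (enum_val i)).

Definition Emx (u v : S) : 'M[R]_#|S| :=
  delta_mx (enum_rank u) (enum_rank v).

(* max_u nu u / mu u; starting the maximum at 0 is harmless for
   distributions *)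
Definition ratio_norm nu mu : R := \big[Num.max/0]_(u : S) (nu u / mu u).

Definition dot_mu mu h1 h2 : R := \sum_u mu u * h1 u * h2 u.

Definition norm_mu mu h : R := Num.sqrt (dot_mu mu h h).

Definition chain_op p h : S -> R := fun u => \sum_v p u v * h v.

Definition spectral_gap mu p : R :=
  1 - sup [set dot_mu mu h (chain_op p h) / norm_mu mu h ^+ 2 |
             h in [set h | \sum_u mu u * h u = 0 /\ h <> cst 0]].

End FiniteChains.

Section MatrixNorms.
Context {R : realType}.

Definition l2_norm n (x : 'cV[R]_n) : R := Num.sqrt (\sum_i x i 0 ^+ 2).

Definition op_norm n (A : 'M[R]_n) : R :=
  sup [set l2_norm (A *m x) | x in [set x : 'cV[R]_n | l2_norm x <= 1]].

Definition frobenius_norm m n (A : 'M[R]_(m, n)) : R :=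
  Num.sqrt (\sum_i \sum_j A i j ^+ 2).

End MatrixNorms.

(* X k is the state of the chain at step k.+1.  The third clause is the Markov
   property P(X_k.+1 = s_k.+1 | X_0 = s_0, .., X_k = s_k) = q(s_k, s_k.+1), with
   the conditional probability multiplied out. *)
Definition markov_chain {R : realType} {disp : measure_display}
    {T : measurableType disp} {S : finType} (Pr : probability T R)
    (X : nat -> T -> S) (init : S -> R) (q : S -> S -> R) : Prop :=
  [/\ forall k s, measurable [set w | X k w = s],
      forall s, Pr [set w | X 0%N w = s] = (init s)%:E
    & forall k (s : nat -> S),
        Pr [set w | forall i, (i <= k.+1)%N -> X i w = s i] =
        (Pr [set w | forall i, (i <= k)%N -> X i w = s i] *
         (q (s k) (s k.+1))%:E)%E].

Section SymmetricPairs.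
Context {S : finType}.

Definition swap_eq (x y : S * S) : bool := (x == y) || (x == (y.2, y.1)).

Lemma swap_eq_refl : reflexive swap_eq.
Proof. by move=> x; rewrite /swap_eq eqxx. Qed.

Lemma swap_eq_sym : symmetric swap_eq.
Proof.
move=> [a b] [c d]; rewrite /swap_eq !xpair_eqE /= (eq_sym c a) (eq_sym d b).
by rewrite (eq_sym c b) (eq_sym d a) [(b == c) && _]andbC.
Qed.

Lemma swap_eq_trans : transitive swap_eq.
Proof.
move=> [a b] [c d] [e f]; rewrite /swap_eq !xpair_eqE /=.
by move=> /orP[]/andP[/eqP-> /eqP->] /orP[]/andP[/eqP-> /eqP->];
  rewrite !eqxx ?orbT.
Qed.

Definition swap_equiv := EquivRel swap_eq swap_eq_refl swap_eq_sym swap_eq_trans.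

End SymmetricPairs.

Definition sym_pairs (S : finType) := {eq_quot @swap_equiv S}.
HB.instance Definition _ (S : finType) := Countable.on (sym_pairs S).
HB.instance Definition _ (S : finType) := EqQuotient.on (sym_pairs S).
HB.instance Definition _ (S : finType) := fintype.isFinite.Build (sym_pairs S)
  (pcan_enumP (can_pcan (@reprK _ (sym_pairs S)))).

Definition cls {S : finType} (u v : S) : sym_pairs S :=
  (\pi_(sym_pairs S) (u, v))%qT.

Lemma clsP {S : finType} (a b c d : S) :
  reflect ((a, b) = (c, d) \/ (a, b) = (d, c)) (cls a b == cls c d).
Proof.
rewrite /cls eqmodE /= /swap_eq /=.
by apply: (iffP orP) => -[] => [/eqP|/eqP|->|->]; rewrite ?eqxx; auto.
Qed.

Lemma cls_repr {S : finType} (q : sym_pairs S) :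
  cls (repr q).1 (repr q).2 = q.
Proof. by rewrite /cls -surjective_pairing reprK. Qed.

Section SymmetricPathSpace.
Context {R : realType} {S : finType}.
Implicit Types (mu nu : S -> R) (p : S -> S -> R) (q : sym_pairs S).

(* The law of the class of (u, v), where u ~ mu and then v ~ p u. *)
Definition pair_law mu p q : R :=
  \sum_(x : S * S | cls x.1 x.2 == q) mu x.1 * p x.1 x.2.

(* Invariant under swapping w1 and w2, so that P2 does not depend on the
   representative; see P2_cls. *)
Definition jump p (w1 w2 : S) q : R :=
  2^-1 * (\sum_(v | cls w2 v == q) p w2 v) +
  2^-1 * (\sum_(v | cls w1 v == q) p w1 v).

Definition P2 p q q' : R := jump p (repr q).1 (repr q).2 q'.

Definition F2 q : 'M[R]_#|S| :=
  2^-1 *: (Emx (repr q).1 (repr q).2 + Emx (repr q).2 (repr q).1).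

Lemma P2_cls p u1 u2 q : P2 p (cls u1 u2) q = jump p u1 u2 q.
Proof.
rewrite /P2; have := cls_repr (cls u1 u2).
case: (repr (cls u1 u2)) => a b /= /eqP/clsP[][-> ->] //.
by rewrite /jump addrC.
Qed.

Lemma F2_cls (w1 w2 : S) : F2 (cls w1 w2) = 2^-1 *: (Emx w1 w2 + Emx w2 w1).
Proof.
rewrite /F2; have := cls_repr (cls w1 w2).
case: (repr (cls w1 w2)) => a b /= /eqP/clsP[][-> ->] //.
by rewrite addrC.
Qed.

(* U k is the (k.+1)-st state of the chain, so this averages the first n
   states. *)
Definition Hmx {T : Type} (U : nat -> T -> sym_pairs S) (n : nat) (w : T) :
    'M[R]_#|S| :=
  n%:R^-1 *: \sum_(k < n) F2 (U k w).

End SymmetricPathSpace.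

(* Main.v *)
Require Import Defs.
From HB Require Import structures.
From mathcomp Require Import all_boot all_order all_algebra.
From mathcomp Require Import all_classical all_reals all_analysis.
From mathcomp Require Import measurable_realfun ring lra.
Import Order.TTheory GRing.Theory Num.Theory.
Import numFieldNormedType.Exports.
Local Open Scope classical_set_scope.
Local Open Scope ring_scope.

(* Let [pl] be the law of the class of an edge of the stationary chain.  For
   [h] on pairs put [psi h u := \sum_v p u v * h (cls u v)], the conditional
   expectation of [h] given the first endpoint.  Then
   [<h, P2 k>_pl = <psi h, psi k>_mu], so [P2] is reversible and positive, and
   Cauchy-Schwarz against [(psi h u + psi h v) / 2] shows that its spectral gap
   is at least [gap := eta / 2].

   (3) The autocovariances of a centred [g] are at most [(1 - gap)^k |g|^2].

   (2) For real [g] with mean zero, variance at most 1 and [g <= 2], comparing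
   the quadratic form of [P2] with that of the multiplication by
   [r * expR (- lam * g)] gives [E (expR (lam * \sum_(k < n) g (u_k))) <= r ^ n].
   Since [\sum_ij `|F2 q i j| <= 1], this applies to every signed combination of
   the entries of [F2]; averaging over signs and using
   [cosh `|X| <= \prod_i cosh (X i)] it bounds
   [E (cosh (lam * `|\sum_k (F2 (u_k) - D_mu P)|))] for the Frobenius norm by the
   same [r ^ n].  The resulting dimension-free tail is stronger than the claimed
   one: of the constants only [pi <= 4] is used.

   (1) The tails are summable, so Borel-Cantelli applies.  That [eta > 0] follows
   from a Poincare inequality: [(h u - h v)^2] is bounded by the Dirichlet form
   along any path of positive probability from [u] to [v]. *)

(** * Weighted bilinear forms on a finite set *)

Section FiniteSums.
Context {R : realType} {S : finType}.
Implicit Types (w h k : S -> R) (q : S -> S -> R).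

Lemma sum_affine w h k (a b : R) :
  \sum_u w u * (a * h u + b * k u) =
  a * (\sum_u w u * h u) + b * (\sum_u w u * k u).
Proof.
by rewrite !mulr_sumr -big_split /=; apply: eq_bigr => u _; ring.
Qed.

Lemma dot_mu_ge0 w h : (forall u, 0 <= w u) -> 0 <= dot_mu w h h.
Proof.
by move=> w0; apply: sumr_ge0 => u _; rewrite -mulrA mulr_ge0// -expr2 sqr_ge0.
Qed.

Lemma dot_muC w h k : dot_mu w h k = dot_mu w k h.
Proof. by apply: eq_bigr => u _; ring. Qed.

Lemma dot_mu_affinel w h h' k (a b : R) :
  dot_mu w (fun u => a * h u + b * h' u) k = a * dot_mu w h k + b * dot_mu w h' k.
Proof.
by rewrite /dot_mu !mulr_sumr -big_split /=; apply: eq_bigr => u _; ring.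
Qed.

Lemma dot_mu_affiner w h h' k (a b : R) :
  dot_mu w k (fun u => a * h u + b * h' u) = a * dot_mu w k h + b * dot_mu w k h'.
Proof. by rewrite !(dot_muC w k) dot_mu_affinel. Qed.

Lemma chain_op_affine q h k (a b : R) :
  chain_op q (fun u => a * h u + b * k u) =
  (fun u => a * chain_op q h u + b * chain_op q k u).
Proof. by apply/funext => u; rewrite /chain_op sum_affine. Qed.

Lemma dot_mu_reversible w q h k : reversible w q ->
  dot_mu w h (chain_op q k) = dot_mu w (chain_op q h) k.
Proof.
move=> wq; rewrite /dot_mu /chain_op.
under eq_bigr do rewrite mulr_sumr.
rewrite exchange_big /=; apply: eq_bigr => v _.
rewrite mulr_sumr mulr_suml; apply: eq_bigr => u _.
by rewrite [LHS](_ : _ = w u * q u v * (h u * k v)); [rewrite wq|]; ring.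
Qed.

Lemma cauchy_schwarz w h k : (forall u, 0 <= w u) ->
  dot_mu w h k ^+ 2 <= dot_mu w h h * dot_mu w k k.
Proof.
move=> w0.
have H (a b : R) : 0 <= a ^+ 2 * dot_mu w h h + 2 * a * b * dot_mu w h k
    + b ^+ 2 * dot_mu w k k.
  have := dot_mu_ge0 w (fun u => a * h u + b * k u) w0.
  rewrite dot_mu_affinel !dot_mu_affiner (dot_muC w k h); set x := (X in 0 <= X).
  by move=> x0; rewrite [leRHS](_ : _ = x)// /x; ring.
have hh := dot_mu_ge0 w h w0; have kk := dot_mu_ge0 w k w0.
set x := dot_mu w h k in H *; set y := dot_mu w h h in H hh *.
set z := dot_mu w k k in H kk *.
have [z0|z0] := eqVneq z 0; last first.
  have zp : 0 < z by rewrite lt_def z0.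
  have := H z (- x); rewrite [leRHS](_ : _ = z * (y * z - x ^+ 2)); last by ring.
  by rewrite pmulr_rge0// subr_ge0.
(* In the degenerate case this choice of [a] and [b] reduces [H] to [0 <= - x ^+ 2]. *)
have := H x (- (y + 1) / 2); rewrite z0 mulr0 addr0 mulr0.
by have := sqr_ge0 x; nra.
Qed.

(* Polarization turns the bound on the quadratic form into the operator norm
   bound [|Mh| <= r |h|], for the semi-norm weighted by [w]. *)
Lemma dot_mu_iter_le w q (V : (S -> R) -> Prop) (r : R) :
  (forall u, 0 <= w u) -> reversible w q -> 0 <= r ->
  (forall h, V h -> V (chain_op q h)) ->
  (forall h k (a b : R), V h -> V k -> V (fun u => a * h u + b * k u)) ->
  (forall h, V h -> `|dot_mu w h (chain_op q h)| <= r * dot_mu w h h) ->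
  forall n h, V h ->
    dot_mu w h (iter n (chain_op q) h) <= r ^+ n * dot_mu w h h.
Proof.
move=> w0 wq r0 Vq Vl Hq.
have norm_le h : V h ->
    dot_mu w (chain_op q h) (chain_op q h) <= r ^+ 2 * dot_mu w h h.
  move=> Vh; pose k := chain_op q h; have Vk := Vq _ Vh.
  (* The upper bound at [h + s k] and the lower bound at [h - s k], subtracted. The value [s = r^-1]
     used below is the optimal one. *)
  have H (s : R) : 2 * s * dot_mu w k k <= r * (dot_mu w h h + s ^+ 2 * dot_mu w k k).
    have H1 := Hq _ (Vl h k 1 s Vh Vk); have H2 := Hq _ (Vl h k 1 (- s) Vh Vk).
    move: H1 H2; rewrite !chain_op_affine !(dot_mu_affinel, dot_mu_affiner).
    rewrite -/k (dot_mu_reversible w q h k)// -/k (dot_muC w k h).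
    by rewrite !ler_norml => /andP[_ H1] /andP[H2 _]; lra.
  have := H r^-1; rewrite -/k.
  have [r00|rN0] := eqVneq r 0.
    by move=> _; have := H 1; rewrite r00; lra.
  have rp : 0 < r by rewrite lt_def rN0.
  move=> /(ler_wpM2l r0).
  rewrite [leLHS](_ : _ = 2 * dot_mu w k k); last by field.
  rewrite [leRHS](_ : _ = r ^+ 2 * dot_mu w h h + dot_mu w k k); last by field.
  by lra.
(* Strong induction: moving one operator to the left argument lowers the power by two. *)
move=> n; suff: forall m, (m <= n)%N -> forall h, V h ->
    dot_mu w h (iter m (chain_op q) h) <= r ^+ m * dot_mu w h h by apply.
elim: n => [|n IH] m; first by rewrite leqn0 => /eqP-> h _; rewrite expr0 mul1r.
case: m => [|[_ h Vh|m mn h Vh]]; first by move=> _ h _; rewrite expr0 mul1r.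
  by rewrite expr1 (le_trans (ler_norm _))// Hq.
rewrite iterS iterSr dot_mu_reversible//.
apply: (le_trans (IH _ (leqW mn) _ (Vq _ Vh))).
rewrite -(addn2 m) exprD -mulrA ler_wpM2l ?exprn_ge0//.
exact: norm_le.
Qed.

End FiniteSums.

(** * Expectations over finite paths *)

Section PathSums.
Context {R : realType} {S : finType}.
Implicit Types (init f g D : S -> R) (q : S -> S -> R) (Phi : (nat -> S) -> R).

(* The truncation [minn i n] freezes a path after its last state, so that
   [path_sumS] holds for every functional [Phi]. *)
Definition path_of n (s : {ffun 'I_n.+1 -> S}) : nat -> S :=
  fun i => s (inord (minn i n)).

Definition path_weight init q n (x : nat -> S) : R :=
  init (x 0%N) * \prod_(i < n) q (x i) (x i.+1).

(** For a distribution [init] and a transition matrix [q], the expectation of [Phi] over the first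
    [n.+1] states of the chain. *)
Definition path_sum init q n Phi : R :=
  \sum_(s : {ffun 'I_n.+1 -> S})
    path_weight init q n (path_of n s) * Phi (path_of n s).

Lemma path_sum0 init q Phi :
  path_sum init q 0 Phi = \sum_u init u * Phi (fun=> u).
Proof.
rewrite /path_sum (reindex (fun u : S => [ffun=> u] : {ffun 'I_1 -> S})) /=.
  apply: eq_bigr => u _; rewrite /path_weight big_ord0 mulr1.
  by rewrite (_ : path_of 0 _ = fun=> u)//; apply/funext => i; rewrite /path_of ffunE.
exists (fun s => s ord0) => [u _|s _]; first by rewrite ffunE.
by apply/ffunP => i; rewrite ffunE (ord1 i).
Qed.

(** One-step conditioning: the last state is integrated out against [q (x n)]. This drives the
    inductions on the path length. *)
Lemma path_sumS init q n Phi : path_sum init q n.+1 Phi =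
  path_sum init q n (fun x =>
    \sum_y q (x n) y * Phi (fun i => if (i <= n)%N then x i else y)).
Proof.
pose ext (sy : {ffun 'I_n.+1 -> S} * S) : {ffun 'I_n.+2 -> S} :=
  [ffun i => if unlift ord_max i is Some j then sy.1 j else sy.2].
have extE s y : path_of n.+1 (ext (s, y)) =
    fun i => if (i <= n)%N then path_of n s i else y.
  apply/funext => i; rewrite /path_of ffunE.
  have [le_in|lt_ni] := leqP i n; last first.
    by rewrite (minn_idPr lt_ni) (_ : inord n.+1 = ord_max) ?unlift_none//;
      apply/val_inj; rewrite /= inordK.
  rewrite (minn_idPl (leqW le_in)).
  rewrite (_ : inord i = lift ord_max (inord i)) ?liftK//.
  by apply/val_inj; rewrite /= !inordK ?ltnS ?(leqW le_in)// /bump leqNgt ltnS le_in.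
rewrite /path_sum (reindex ext) /=; last first.
  exists (fun s => ([ffun i => s (lift ord_max i)], s ord_max)) => [[s y] _|s _].
    by congr pair; [apply/ffunP => i|]; rewrite !ffunE ?liftK ?unlift_none.
  by apply/ffunP => i; rewrite ffunE; case: unliftP => [j|] ->; rewrite ?ffunE.
rewrite -(pair_bigA _ (fun s y => path_weight init q n.+1 (path_of n.+1 (ext (s, y))) *
  Phi (path_of n.+1 (ext (s, y))))) /=.
apply: eq_bigr => s _; rewrite mulr_sumr; apply: eq_bigr => y _.
rewrite extE mulrA; congr (_ * _); rewrite /path_weight /= big_ord_recr /= leqnn ltnn.
rewrite mulrA; congr (_ * _ * _); apply: eq_bigr => i _.
by rewrite (ltn_ord i) ltnW.
Qed.

Lemma eq_path_sum init q n Phi Psi : Phi =1 Psi ->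
  path_sum init q n Phi = path_sum init q n Psi.
Proof. by move=> PhiPsi; apply: eq_bigr => s _; rewrite PhiPsi. Qed.

Lemma path_sumD init q n Phi Psi : path_sum init q n (fun x => Phi x + Psi x) =
  path_sum init q n Phi + path_sum init q n Psi.
Proof. by rewrite -big_split; apply: eq_bigr => s _; rewrite mulrDr. Qed.

Lemma path_sumZ init q n c Phi :
  path_sum init q n (fun x => c * Phi x) = c * path_sum init q n Phi.
Proof. by rewrite mulr_sumr; apply: eq_bigr => s _; rewrite mulrCA. Qed.

Lemma path_sum_sum init q n (I : finType) (Phi : I -> (nat -> S) -> R) :
  path_sum init q n (fun x => \sum_i Phi i x) =
  \sum_i path_sum init q n (Phi i).
Proof.
by rewrite /path_sum exchange_big /=; apply: eq_bigr => s _; rewrite mulr_sumr.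
Qed.

Section Monotonicity.
Context {q : S -> S -> R}.
Hypothesis q_transition : transition_matrix q.

Lemma path_weight_ge0 init n x : (forall u, 0 <= init u) ->
  0 <= path_weight init q n x.
Proof.
by move=> init0; rewrite mulr_ge0 ?prodr_ge0// => i _; apply: (q_transition _).1.
Qed.

Lemma ler_path_sum init n Phi Psi : (forall u, 0 <= init u) ->
  (forall x, Phi x <= Psi x) -> path_sum init q n Phi <= path_sum init q n Psi.
Proof.
by move=> init0 H; apply: ler_sum => s _; rewrite ler_wpM2l ?path_weight_ge0.
Qed.

(** Change of initial law; it is the source of the factor [ratio_norm nu mu]. *)
Lemma ler_path_sum_init (init init' : S -> R) (c : R) n Phi :
  (forall u, init u <= c * init' u) -> (forall x, 0 <= Phi x) ->
  path_sum init q n Phi <= c * path_sum init' q n Phi.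
Proof.
move=> H Phi0; rewrite mulr_sumr; apply: ler_sum => s _.
rewrite mulrA ler_wpM2r// /path_weight mulrA ler_wpM2r//.
by apply: prodr_ge0 => i _; apply: (q_transition _).1.
Qed.

End Monotonicity.

(** A Feynman-Kac formula: the factor [D] at each arrival state is absorbed into the kernel, and
    only that of the initial state remains. In the induction one step replaces [f] by its image
    under the tilted operator. *)
Lemma path_sum_prod init q D f n :
  path_sum init q n (fun x => (\prod_(i < n.+1) D (x i)) * f (x n)) =
  \sum_u init u * D u * iter n (chain_op (fun u v => q u v * D v)) f u.
Proof.
elim: n f => [|n IH] f.
  by rewrite path_sum0; apply: eq_bigr => u _; rewrite big_ord1 mulrA.
rewrite path_sumS iterSr -IH; apply: eq_path_sum => x.
rewrite mulr_sumr; apply: eq_bigr => y _; rewrite big_ord_recr /= ltnn.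
under eq_bigr => i _ do rewrite -ltnS (ltn_ord i).
by ring.
Qed.

End PathSums.

(** * The hyperbolic cosine of a Euclidean norm *)

Section Cosh.
Context {R : realType}.
Implicit Types (x y a b c : R).

Definition cosh x : R := (expR x + expR (- x)) / 2.

Lemma expR_le_cosh x : expR x / 2 <= cosh x.
Proof. by rewrite ler_wpM2r ?invr_ge0// lerDl expR_ge0. Qed.

Lemma cosh_gt0 x : 0 < cosh x.
Proof. by rewrite divr_gt0// addr_gt0// expR_gt0. Qed.

Lemma cosh0 : cosh 0 = 1.
Proof. by rewrite /cosh oppr0 expR0; field. Qed.

Lemma ler_cosh x y : 0 <= x -> x <= y -> cosh x <= cosh y.
Proof.
move=> x0 xy; rewrite ler_wpM2r ?invr_ge0// -subr_ge0.
have -> : expR y + expR (- y) - (expR x + expR (- x)) =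
    (expR y - expR x) * (1 - expR (- (x + y))).
  have exN z : expR z * expR (- z) = 1 by rewrite -expRD subrr expR0.
  rewrite (opprD x y) expRD.
  rewrite [RHS](_ : _ = expR y - expR x - expR (- x) * (expR y * expR (- y)) +
    expR x * expR (- x) * expR (- y)); last by ring.
  by rewrite !exN; ring.
rewrite mulr_ge0// subr_ge0; first by rewrite ler_expR.
by rewrite -[leRHS]expR0 ler_expR; lra.
Qed.

(** Midpoint convexity of the power, by induction from [(y - z) * (y ^+ n - z ^+ n) >= 0]. *)
Lemma mean_exprn_le y z n : 0 <= y -> 0 <= z ->
  2 * ((y + z) / 2) ^+ n <= y ^+ n + z ^+ n.
Proof.
move=> y0 z0; elim: n => [|n IH]; first by rewrite !expr0; lra.
have yz : 0 <= (y - z) * (y ^+ n - z ^+ n).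
  have [le_yz|lt_zy] := leP y z.
    by rewrite mulr_le0// subr_le0// lerXn2r.
  by rewrite mulr_ge0// subr_ge0 ?lerXn2r// ltW.
rewrite !exprS.
have : (y + z) / 2 * (2 * ((y + z) / 2) ^+ n) <= (y + z) / 2 * (y ^+ n + z ^+ n).
  by rewrite ler_wpM2l// divr_ge0// addr_ge0.
by move: (_ ^+ n) (_ ^+ n) (_ ^+ n) yz => A B C; lra.
Qed.

Lemma exprnN_sum x n : x ^+ n + (- x) ^+ n = 2 * (~~ odd n)%:R * (x ^+ 2) ^+ n./2.
Proof.
rewrite exprNn -signr_odd -exprM mul2n; case: (boolP (odd n)) => [_|n_even] /=.
  by rewrite expr1; ring.
by rewrite even_halfK// expr0; ring.
Qed.

(* [fun y => cosh (Num.sqrt y)] is convex, since its power series has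
   nonnegative coefficients. *)
Lemma cosh_mean_le a b c : c ^+ 2 = a ^+ 2 + b ^+ 2 ->
  2 * cosh c <= cosh (a + b) + cosh (a - b).
Proof.
move=> abc; pose s x n := series (exp_coeff x) n + series (exp_coeff (- x)) n.
have s_cvg x : s x @ \oo --> expR x + expR (- x).
  by apply: cvgD; apply: is_cvg_series_exp_coeff.
have : 2 * (expR c + expR (- c)) <=
    (expR (a + b) + expR (- (a + b))) + (expR (a - b) + expR (- (a - b))).
  (* The partial sums are compared term by term: odd terms cancel, and even terms are powers of
     squares, with [c ^+ 2] the mean of [(a + b) ^+ 2] and [(a - b) ^+ 2]. *)
  apply: (@ler_cvg_to _ \oo _ _ (fun n => 2 * s c n) (fun n => s (a + b) n + s (a - b) n)).
  - by apply: cvgM; [exact: cvg_cst|exact: s_cvg].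
  - by apply: cvgD; exact: s_cvg.
  apply: nearW => n; rewrite /s /series /= -!big_split mulr_sumr /=.
  apply: ler_sum => k _; rewrite /exp_coeff /=.
  rewrite -!mulrDl mulrA ler_wpM2r ?invr_ge0// !exprnN_sum abc.
  have := mean_exprn_le ((a + b) ^+ 2) ((a - b) ^+ 2) k./2 (sqr_ge0 _) (sqr_ge0 _).
  have -> : ((a + b) ^+ 2 + (a - b) ^+ 2) / 2 = a ^+ 2 + b ^+ 2 by field.
  move=> H; case: (odd k) => /=; first by rewrite mulr0 !mul0r mulr0 addr0.
  by lra.
by rewrite /cosh; lra.
Qed.

Lemma cosh_sqrtD_le a b : cosh (Num.sqrt (a ^+ 2 + b ^+ 2)) <= cosh a * cosh b.
Proof.
have := cosh_mean_le a b (Num.sqrt (a ^+ 2 + b ^+ 2)).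
rewrite sqr_sqrtr ?addr_ge0 ?sqr_ge0// => /(_ erefl).
have -> : cosh (a + b) + cosh (a - b) = 2 * (cosh a * cosh b).
  by rewrite /cosh !opprD opprK !expRD; field.
by rewrite ler_pM2l.
Qed.

Lemma cosh_sqrt_sum_le (I : finType) (X : I -> R) :
  cosh (Num.sqrt (\sum_i X i ^+ 2)) <= \prod_i cosh (X i).
Proof.
(* The sum and the product are built up together; [0 <= s] lets [s] be rewritten as a square in
   [cosh_sqrtD_le]. *)
pose K s p := 0 <= s /\ cosh (Num.sqrt s) <= p.
suff [] : K (\sum_i X i ^+ 2) (\prod_i cosh (X i)) by [].
apply: (big_ind2 K) => [|s1 p1 s2 p2 [s10 le1] [s20 le2]|i _].
- by split => //; rewrite sqrtr0 cosh0.
- split; first exact: addr_ge0.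
  rewrite -{1}(sqr_sqrtr s10) -{1}(sqr_sqrtr s20).
  by apply: (le_trans (cosh_sqrtD_le _ _)); apply: ler_pM => //; apply/ltW/cosh_gt0.
- split; first exact: sqr_ge0.
  rewrite sqrtr_sqr; have [_|_] := ger0P (X i); first exact: lexx.
  by rewrite /cosh opprK addrC.
Qed.

End Cosh.

(** * Variance and tail bounds for a positive reversible chain with a gap *)

Section ReversibleChain.
Context {R : realType} {S : finType} {w : S -> R} {q : S -> S -> R} {gap : R}.
Hypothesis w_distribution : distribution_on w.
Hypothesis q_transition : transition_matrix q.
Hypothesis q_reversible : reversible w q.
Hypothesis q_ge0 : forall h, 0 <= dot_mu w h (chain_op q h).
Hypothesis q_gap : forall h, \sum_u w u * h u = 0 ->
  dot_mu w h (chain_op q h) <= (1 - gap) * dot_mu w h h.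
Hypothesis gap_gt0 : 0 < gap.
Hypothesis gap_le1 : gap <= 1.
Implicit Types (h k g f : S -> R) (n : nat).

Let w0 u : 0 <= w u. Proof. exact: w_distribution.1. Qed.

Let chain_op1 : chain_op q (fun=> 1) = fun=> 1.
Proof.
apply/funext => u; rewrite /chain_op.
by under eq_bigr do rewrite mulr1; exact: (q_transition u).2.
Qed.

Lemma stationary_mean h : \sum_u w u * chain_op q h u = \sum_u w u * h u.
Proof.
have := dot_mu_reversible w q (fun=> 1) h q_reversible; rewrite chain_op1 /dot_mu.
by under eq_bigr do rewrite mulr1; under [RHS]eq_bigr do rewrite mulr1.
Qed.

Lemma dot_mu_centered h (m := \sum_u w u * h u) :
  dot_mu w h h = m ^+ 2 + dot_mu w (fun u => h u - m) (fun u => h u - m).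
Proof.
have -> : (fun u => h u - m) = (fun u => 1 * h u + (- m) * (fun=> 1) u).
  by apply/funext => u; rewrite /= mul1r mulr1.
rewrite dot_mu_affinel !dot_mu_affiner (dot_muC w (fun=> 1) h).
have -> : dot_mu w h (fun=> 1) = m by apply: eq_bigr => u _; rewrite /= mulr1.
have -> : dot_mu w (fun=> 1) (fun=> 1) = 1.
  rewrite -[RHS]w_distribution.2.
  by apply: eq_bigr => u _; rewrite /= !mulr1.
by ring.
Qed.

Lemma sum_centered h (m := \sum_u w u * h u) : \sum_u w u * (h u - m) = 0.
Proof.
under eq_bigr do rewrite mulrBr.
by rewrite sumrB -mulr_suml w_distribution.2 mul1r subrr.
Qed.

Lemma dot_mu_chain_op_centered h (m := \sum_u w u * h u) :
  dot_mu w h (chain_op q h) =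
  m ^+ 2 + dot_mu w (fun u => h u - m) (chain_op q (fun u => h u - m)).
Proof.
have -> : (fun u => h u - m) = (fun u => 1 * h u + (- m) * (fun=> 1) u).
  by apply/funext => u; rewrite /= mul1r mulr1.
rewrite chain_op_affine chain_op1 dot_mu_affinel !dot_mu_affiner.
have -> : dot_mu w h (fun=> 1) = m by apply: eq_bigr => u _; rewrite /= mulr1.
have -> : dot_mu w (fun=> 1) (fun=> 1) = 1.
  rewrite -[RHS]w_distribution.2.
  by apply: eq_bigr => u _; rewrite /= !mulr1.
rewrite (dot_mu_reversible w q (fun=> 1))// chain_op1.
have -> : dot_mu w (fun=> 1) h = m by apply: eq_bigr => u _; rewrite /= mulr1.
by ring.
Qed.

Lemma iter_chain_op_gap h n : \sum_u w u * h u = 0 ->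
  dot_mu w h (iter n (chain_op q) h) <= (1 - gap) ^+ n * dot_mu w h h.
Proof.
move=> h0; apply: (dot_mu_iter_le w q (fun h => \sum_u w u * h u = 0)) => //.
- by rewrite subr_ge0.
- by move=> k k0; rewrite stationary_mean.
- by move=> k f a b k0 f0; rewrite sum_affine k0 f0 !mulr0 addr0.
- by move=> k k0; rewrite ger0_norm ?q_gap ?q_ge0.
Qed.

Lemma path_sum_last h n :
  path_sum w q n (fun x => h (x n)) = \sum_u w u * h u.
Proof.
elim: n h => [|n IH] h; first exact: path_sum0.
rewrite path_sumS -[RHS]stationary_mean -IH; apply: eq_path_sum => x.
by rewrite ltnn.
Qed.

(** In the stationary chain the covariance of [g] and [f] at distance [j] is the [j]-th term.
    Conditioning on the last step replaces [f] by [chain_op q f], hence the general [f]. *)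
Lemma path_sum_cov g f n :
  path_sum w q n (fun x => (\sum_(i < n.+1) g (x i)) * f (x n)) =
  \sum_(j < n.+1) dot_mu w g (iter j (chain_op q) f).
Proof.
elim: n f => [|n IH] f.
  rewrite path_sum0 big_ord1; apply: eq_bigr => u _.
  by rewrite big_ord1 mulrA.
rewrite path_sumS big_ord_recl /=.
under [X in _ + X]eq_bigr do rewrite -iterS iterSr.
rewrite -IH.
have -> : dot_mu w g f = path_sum w q n (fun x => chain_op q (fun y => g y * f y) (x n)).
  rewrite path_sum_last stationary_mean.
  by apply: eq_bigr => u _; rewrite mulrA.
rewrite -path_sumD; apply: eq_path_sum => x.
rewrite [X in _ = _ + X]mulr_sumr -big_split; apply: eq_bigr => y _ /=.
rewrite big_ord_recr /= ltnn.
under eq_bigr => i _ do rewrite -ltnS (ltn_ord i).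
by ring.
Qed.

(** Each new state adds its variance and twice its covariance with the preceding sum. The latter is
    at most a geometric series of value [(1 - gap) / gap], and [1 + 2 * (1 - gap) / gap = (2 - gap)
    / gap]. *)
Lemma path_sum_sqr_le g n : \sum_u w u * g u = 0 ->
  path_sum w q n (fun x => (\sum_(i < n.+1) g (x i)) ^+ 2) <=
  n.+1%:R * ((2 - gap) / gap * dot_mu w g g).
Proof.
move=> g0; have gg := dot_mu_ge0 w g w0.
have geom m : gap * \sum_(j < m) (1 - gap) ^+ j.+1 = (1 - gap) - (1 - gap) ^+ m.+1.
  elim: m => [|m IH]; first by rewrite big_ord0 mulr0 expr1 subrr.
  by rewrite big_ord_recr mulrDr IH [in RHS]exprS /=; ring.
elim: n => [|n IH].
  rewrite mul1r path_sum0 -[leLHS]mul1r.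
  have -> : \sum_u w u * (\sum_(i < 1) g u) ^+ 2 = dot_mu w g g.
    by apply: eq_bigr => u _; rewrite big_ord1 expr2 mulrA.
  by rewrite ler_wpM2r// ler_pdivlMr// mul1r; move: gap_le1; lra.
rewrite path_sumS.
rewrite (eq_path_sum _ _ _ _ (fun x => (\sum_(i < n.+1) g (x i)) ^+ 2 +
    (2 * ((\sum_(i < n.+1) g (x i)) * chain_op q g (x n)) +
     chain_op q (fun u => g u * g u) (x n)))); last first.
  move=> x.
  transitivity (\sum_y q (x n) y * (\sum_(i < n.+1) g (x i) + g y) ^+ 2).
    apply: eq_bigr => y _; rewrite big_ord_recr /= ltnn.
    by under eq_bigr => i _ do rewrite -ltnS (ltn_ord i).
  move: (\sum_(i < n.+1) g (x i)) => G; rewrite /chain_op.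
  rewrite -[X in _ = X + _]mul1r -[X in _ = X * _ + _](q_transition (x n)).2.
  rewrite !mulr_suml !mulr_sumr -!big_split; apply: eq_bigr => y _ /=.
  by ring.
rewrite !path_sumD path_sumZ path_sum_cov path_sum_last stationary_mean.
have -> : \sum_u w u * (g u * g u) = dot_mu w g g.
  by apply: eq_bigr => u _; rewrite mulrA.
have cov_le : \sum_(j < n.+1) dot_mu w g (iter j (chain_op q) (chain_op q g)) <=
    (1 - gap) / gap * dot_mu w g g.
  apply: (@le_trans _ _ (\sum_(j < n.+1) (1 - gap) ^+ j.+1 * dot_mu w g g)).
    by apply: ler_sum => j _; rewrite -iterSr iter_chain_op_gap.
  rewrite -mulr_suml ler_wpM2r// ler_pdivlMr// mulrC geom lerBlDr lerDl.
  by rewrite exprn_ge0// subr_ge0.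
rewrite -(natr1 n.+1) [leRHS]mulrDl mul1r; apply: (lerD IH).
have -> : (2 - gap) / gap * dot_mu w g g =
    2 * ((1 - gap) / gap * dot_mu w g g) + dot_mu w g g by field; rewrite gt_eqF.
by rewrite lerD2r ler_wpM2l.
Qed.

(** * Exponential tilting by one centred function *)

Section Tilt.
Context {g : S -> R} {lam r : R}.
Hypothesis g0 : \sum_u w u * g u = 0.
Hypothesis g_var : dot_mu w g g <= 1.
Hypothesis g_le2 : forall u, g u <= 2.
Hypothesis lam_ge0 : 0 <= lam.
Hypothesis r_gt1 : 1 < r.
Hypothesis lam_r : (lam * r) ^+ 2 <= (r - 1) * (gap + (r - 1) - 2 * (lam * r)).

(* After the bound [1 - y <= expR (- y)] and the splitting of [k] into its mean
   and a centred part, only a quadratic form in two variables is left. *)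
Lemma tilted_form_le k :
  dot_mu w k (chain_op q k) <= r * dot_mu w k (fun u => expR (- (lam * g u)) * k u).
Proof.
set m := \sum_u w u * k u; set l := fun u => k u - m.
have r0 : 0 <= r by move: r_gt1; lra.
rewrite dot_mu_chain_op_centered -/m.
apply: (@le_trans _ _ (m ^+ 2 + (1 - gap) * dot_mu w l l)).
  by rewrite lerD2l; apply/q_gap/sum_centered.
apply: (@le_trans _ _ (r * (dot_mu w k k - lam * (\sum_u w u * g u * k u ^+ 2)))).
  have -> : \sum_u w u * g u * k u ^+ 2 =
      2 * m * dot_mu w g l + \sum_u w u * g u * l u ^+ 2.
    rewrite /dot_mu mulr_sumr -big_split /=.
    have -> : \sum_u w u * g u * k u ^+ 2 =
        \sum_u w u * g u * k u ^+ 2 - m ^+ 2 * \sum_u w u * g u by rewrite g0; ring.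
    by rewrite mulr_sumr -sumrB; apply: eq_bigr => u _; rewrite /l; ring.
  rewrite (dot_mu_centered k) -/m -/l.
  have gl : \sum_u w u * g u * l u ^+ 2 <= 2 * dot_mu w l l.
    rewrite mulr_sumr; apply: ler_sum => u _.
    rewrite [leRHS](_ : _ = w u * 2 * l u ^+ 2); last by ring.
    by rewrite ler_wpM2r ?sqr_ge0// ler_wpM2l.
  have := cauchy_schwarz w g l w0; have := dot_mu_ge0 w l w0.
  move: (dot_mu w g l) (dot_mu w l l) gl => b L gl L0 bL.
  have {}gl : r * lam * (\sum_u w u * g u * l u ^+ 2) <= r * lam * (2 * L).
    by rewrite ler_wpM2l// mulr_ge0.
  apply: (@le_trans _ _ (r * (m ^+ 2 + L) - 2 * m * b * (lam * r) -
    r * lam * (2 * L))); last by lra.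
  have b2 : (lam * r * b) ^+ 2 <= (r - 1) * (gap + (r - 1) - 2 * (lam * r)) * L.
    rewrite exprMn; apply: (@le_trans _ _ ((lam * r) ^+ 2 * L)).
      rewrite ler_wpM2l ?sqr_ge0// (le_trans bL)//.
      by rewrite -[leRHS]mul1r ler_wpM2r.
    by rewrite ler_wpM2r.
  have r1 : 0 < r - 1 by rewrite subr_gt0.
  (* Multiplying by [r - 1] completes the square in [m]. What remains is nonnegative by [lam_r],
     since [b ^+ 2 <= L] by Cauchy-Schwarz and [g_var]. *)
  rewrite -subr_ge0 -(pmulr_rge0 _ r1).
  apply: (@le_trans _ _ (((r - 1) * m - lam * r * b) ^+ 2 +
    ((r - 1) * (gap + (r - 1) - 2 * (lam * r)) * L - (lam * r * b) ^+ 2))).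
    by rewrite addr_ge0 ?sqr_ge0// subr_ge0.
  by rewrite le_eqVlt; apply/orP; left; apply/eqP; ring.
rewrite ler_wpM2l// mulr_sumr -sumrB; apply: ler_sum => u _.
rewrite [leLHS](_ : _ = w u * k u ^+ 2 * (1 - lam * g u)); last by ring.
rewrite [leRHS](_ : _ = w u * k u ^+ 2 * expR (- (lam * g u))); last by ring.
by apply: ler_wpM2l (expR_ge1Dx _); rewrite mulr_ge0 ?sqr_ge0.
Qed.

Let e u := expR (lam * g u).

(** For [k = e] the right side of [tilted_form_le] is [r] times the mean of [e], while by positivity
    of [q] the left side is at least the square of that mean. *)
Lemma tilted_mean_le : \sum_u w u * e u <= r.
Proof.
have := tilted_form_le e.
have -> : dot_mu w e (fun u => expR (- (lam * g u)) * e u) = \sum_u w u * e u.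
  by apply: eq_bigr => u _; rewrite /e expRN mulVf ?mulr1 ?gt_eqF ?expR_gt0.
rewrite dot_mu_chain_op_centered; set m := \sum_u w u * e u.
have := q_ge0 (fun u => e u - m).
have : 0 <= m by apply: sumr_ge0 => u _; rewrite mulr_ge0 ?expR_ge0.
have := r_gt1; move: (dot_mu _ _ _) => z; nra.
Qed.

(** The tilted kernel [q'] is reversible for [w'], and [tilted_form_le] at [k = e * h] bounds its
    quadratic form by [r]. So [dot_mu_iter_le] accounts for the [n] transitions and [tilted_mean_le]
    for the initial state. *)
Lemma tilted_iter_le n :
  \sum_u w u * e u * iter n (chain_op (fun u v => q u v * e v)) (fun=> 1) u <=
  r ^+ n.+1.
Proof.
pose w' u := w u * e u; pose q' u v := q u v * e v.
have eN u : expR (- (lam * g u)) * e u = 1.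
  by rewrite /e expRN mulVf ?gt_eqF ?expR_gt0.
have form h : dot_mu w' h (chain_op q' h) =
    dot_mu w (fun u => e u * h u) (chain_op q (fun u => e u * h u)).
  apply: eq_bigr => u _; rewrite /w' mulrA; congr (_ * _).
  by apply: eq_bigr => v _; rewrite /q' mulrA.
have w'0 u : 0 <= w' u by rewrite mulr_ge0 ?expR_ge0.
have r0 : 0 <= r by move: r_gt1; lra.
have H : dot_mu w' (fun=> 1) (iter n (chain_op q') (fun=> 1)) <=
    r ^+ n * dot_mu w' (fun=> 1) (fun=> 1).
  apply: (dot_mu_iter_le w' q' (fun=> True)) => //.
    by move=> u v; rewrite /w' /q' mulrACA [in RHS]mulrACA q_reversible (mulrC (e u)).
  move=> h _; rewrite form ger0_norm ?q_ge0//.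
  apply: (le_trans (tilted_form_le _)); rewrite ler_wpM2l//.
  rewrite le_eqVlt; apply/orP; left; apply/eqP/eq_bigr => u _.
  transitivity (w u * e u * h u * h u * (expR (- (lam * g u)) * e u)); first by ring.
  by rewrite eN mulr1.
rewrite exprSr; apply: le_trans (ler_wpM2l (exprn_ge0 n r0) tilted_mean_le).
have -> : \sum_u w u * e u = dot_mu w' (fun=> 1) (fun=> 1).
  by apply: eq_bigr => u _; rewrite !mulr1.
by apply: le_trans H; under [leRHS]eq_bigr do rewrite mulr1.
Qed.

Lemma path_sum_expR_le n :
  path_sum w q n (fun x => expR (lam * \sum_(i < n.+1) g (x i))) <= r ^+ n.+1.
Proof.
apply: le_trans (tilted_iter_le n); rewrite -path_sum_prod.
rewrite le_eqVlt; apply/orP; left; apply/eqP/eq_path_sum => x.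
by rewrite mulr1 mulr_sumr expR_sum.
Qed.

End Tilt.
(** The scalar bound is summed over coordinates. Since [F u i ^+ 2 <= |F u i|], the variances add up
    to at most 1, whatever the size of [I]. *)
Lemma path_sum_sqr_norm_le (I : finType) (F : S -> I -> R) n
    (m := fun i => \sum_u w u * F u i) :
  (forall u, \sum_i `|F u i| <= 1) ->
  path_sum w q n (fun x => \sum_i (\sum_(k < n.+1) (F (x k) i - m i)) ^+ 2) <=
  n.+1%:R * ((2 - gap) / gap).
Proof.
move=> F1; rewrite path_sum_sum.
have kappa0 : 0 <= (2 - gap) / gap.
  by rewrite divr_ge0 ?(ltW gap_gt0)//; move: gap_le1; lra.
apply: (@le_trans _ _ (n.+1%:R * ((2 - gap) / gap *
    \sum_i \sum_u w u * `|F u i|))); last first.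
  rewrite ler_wpM2l// -[leRHS]mulr1 ler_wpM2l// exchange_big /=.
  rewrite -w_distribution.2; apply: ler_sum => u _.
  by rewrite -mulr_sumr -[leRHS]mulr1 ler_wpM2l.
rewrite !mulr_sumr; apply: ler_sum => i _.
have := path_sum_sqr_le (fun u => F u i - m i) n (sum_centered (F^~ i)).
move/le_trans; apply.
rewrite ler_wpM2l// ler_wpM2l//.
apply: (@le_trans _ _ (dot_mu w (F^~ i) (F^~ i))).
  by rewrite (dot_mu_centered (F^~ i)) lerDr sqr_ge0.
apply: ler_sum => u _; rewrite -mulrA ler_wpM2l// -expr2 -real_normK ?num_real//.
rewrite expr2 -[leRHS]mulr1 ler_wpM2l//; apply: le_trans (F1 u).
by rewrite (bigD1 i)//= lerDl sumr_ge0.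
Qed.

(** * From scalar to Euclidean exponential moments *)

Section CenteredMgf.
Context {lam r : R}.
Hypothesis lam_ge0 : 0 <= lam.
Hypothesis r_gt1 : 1 < r.
Hypothesis lam_r : (lam * r) ^+ 2 <= (r - 1) * (gap + (r - 1) - 2 * (lam * r)).

(** A function bounded by 1 has variance at most 1 and, once centred, is at most 2, as tilting
    requires. *)
Lemma path_sum_expR_centered_le f n (m := \sum_u w u * f u) :
  (forall u, `|f u| <= 1) ->
  path_sum w q n (fun x => expR (lam * \sum_(i < n.+1) (f (x i) - m))) <= r ^+ n.+1.
Proof.
move=> f1; apply: (path_sum_expR_le (sum_centered f) _ _ lam_ge0 r_gt1 lam_r).
  apply: (@le_trans _ _ (dot_mu w f f)).
    by rewrite (dot_mu_centered f) lerDr sqr_ge0.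
  rewrite -w_distribution.2; apply: ler_sum => u _.
  rewrite -[leRHS]mulr1 -mulrA ler_wpM2l// -expr2.
  by rewrite -real_normK ?num_real// exprn_ile1.
have m1 : - 1 <= m.
  rewrite -subr_ge0 opprK -[X in _ + X]w_distribution.2 -big_split.
  apply: sumr_ge0 => v _ /=; rewrite -[X in _ + X]mulr1 -mulrDr mulr_ge0//.
  by have := f1 v; rewrite ler_norml => /andP[]; lra.
move=> u; have := f1 u; rewrite ler_norml => /andP[_ fu].
by rewrite -/m; lra.
Qed.

(* Averaging [expR] over random signs turns the scalar bound into a bound for
   the Euclidean norm. *)
Lemma path_sum_cosh_le (I : finType) (F : S -> I -> R) n
    (m := fun i => \sum_u w u * F u i) :
  (forall u, \sum_i `|F u i| <= 1) ->
  path_sum w q n (fun x => cosh (lam *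
    Num.sqrt (\sum_i (\sum_(k < n.+1) (F (x k) i - m i)) ^+ 2))) <= r ^+ n.+1.
Proof.
move=> F1; pose sg (eps : {ffun I -> bool}) i : R := (-1) ^+ eps i.
pose f eps u := \sum_i sg eps i * F u i.
have f1 eps u : `|f eps u| <= 1.
  apply: (le_trans (ler_norm_sum _ _ _)); apply: le_trans (F1 u).
  by apply: ler_sum => i _; rewrite normrM normrX normrN1 expr1n mul1r.
have fm eps : \sum_u w u * f eps u = \sum_i sg eps i * m i.
  under eq_bigr do rewrite mulr_sumr.
  rewrite exchange_big; apply: eq_bigr => i _.
  by rewrite mulr_sumr; apply: eq_bigr => u _; rewrite mulrCA.
(* The total mass of the uniform law on sign vectors. *)
pose c : R := \sum_(eps : {ffun I -> bool}) \prod_(i : I) 2^-1.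
have c1 : c = 1.
  rewrite /c -(bigA_distr_bigA (fun (_ : I) (_ : bool) => 2^-1 : R)).
  by rewrite big1// => i _; rewrite big_bool /=; field.
apply: (@le_trans _ _ (path_sum w q n (fun x =>
  \sum_(eps : {ffun I -> bool}) (\prod_(i : I) 2^-1) *
    expR (lam * \sum_(k < n.+1) (f eps (x k) - \sum_u w u * f eps u))))).
  apply: ler_path_sum => // x; set X := fun i => \sum_(k < n.+1) (F (x k) i - m i).
  have -> : lam * Num.sqrt (\sum_i X i ^+ 2) = Num.sqrt (\sum_i (lam * X i) ^+ 2).
    rewrite -{1}(ger0_norm lam_ge0) -sqrtr_sqr -sqrtrM ?sqr_ge0// mulr_sumr.
    by congr Num.sqrt; apply: eq_bigr => i _; rewrite exprMn.
  apply: (le_trans (cosh_sqrt_sum_le _ _)).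
  (* Each [cosh] is a mean of [expR] over one sign; expanding the product gives the mean over all
     sign vectors. *)
  rewrite [leLHS](_ : _ = \prod_i \sum_(b : bool) 2^-1 * expR ((-1) ^+ b * (lam * X i))).
    rewrite bigA_distr_bigA; apply: ler_sum => eps _.
    rewrite big_split /= -expR_sum le_eqVlt; apply/orP; left; apply/eqP.
    congr (_ * expR _); rewrite fm.
    transitivity (lam * \sum_i \sum_(k < n.+1) sg eps i * (F (x k) i - m i)).
      rewrite mulr_sumr; apply: eq_bigr => i _.
      by rewrite mulrCA /X -mulr_sumr.
    rewrite exchange_big /=; congr (_ * _); apply: eq_bigr => k _.
    by rewrite -sumrB; apply: eq_bigr => i _; rewrite mulrBr.
  by apply: eq_bigr => i _; rewrite big_bool /= expr1 expr0 mul1r mulN1r /cosh; field.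
rewrite path_sum_sum -[leRHS]mul1r -[X in _ <= X * _]c1 /c mulr_suml.
apply: ler_sum => eps _; rewrite path_sumZ.
apply: ler_wpM2l; first by apply: prodr_ge0 => i _; rewrite invr_ge0.
exact: path_sum_expR_centered_le.
Qed.

End CenteredMgf.

(** Markov's inequality for [cosh (lam * _)]. The factor 2 comes from [expR_le_cosh], and
    [r ^+ n.+1] is bounded through [1 + delta <= expR delta]. *)
Lemma path_sum_tail_le (I : finType) (F : S -> I -> R) n (t : R)
    (m := fun i => \sum_u w u * F u i) :
  (forall u, \sum_i `|F u i| <= 1) -> 0 < t ->
  path_sum w q n (fun x => (n.+1%:R * t <=
    Num.sqrt (\sum_i (\sum_(k < n.+1) (F (x k) i - m i)) ^+ 2))%R%:R) <=
  2 * expR (- (n.+1%:R * (gap * t ^+ 2 / (4 + 8 * t)))).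
Proof.
move=> F1 t0.
(* With [x := t / (2 + 4 * t)], these are the solutions of [lam * r = gap * x]
   and [r - 1 = delta = gap * x ^+ 2 / (1 - 2 * x)]. *)
pose delta := gap * t ^+ 2 / ((2 + 4 * t) * (2 + 2 * t)).
pose r := 1 + delta; pose lam := gap * t / (2 + 4 * t) / r.
have d0 : 0 < delta.
  by rewrite divr_gt0// mulr_gt0// ?exprn_gt0//; lra.
have r1 : 1 < r by rewrite ltrDl.
have r0 : 0 < r by lra.
have lam0 : 0 <= lam.
  by rewrite divr_ge0 ?(ltW r0)// divr_ge0 ?mulr_ge0//; [exact: ltW..|lra].
have lamr : lam * r = gap * t / (2 + 4 * t) by rewrite /lam divfK// gt_eqF.
have lam_r : (lam * r) ^+ 2 <= (r - 1) * (gap + (r - 1) - 2 * (lam * r)).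
  rewrite lamr (_ : r - 1 = delta); last by rewrite /r; ring.
  rewrite [leRHS](_ : _ = delta ^+ 2 + (gap * t / (2 + 4 * t)) ^+ 2).
    by rewrite lerDr sqr_ge0.
  by rewrite /delta; field; apply/andP; split; rewrite gt_eqF//; lra.
have rate : gap * t ^+ 2 / (4 + 8 * t) <= lam * t - delta.
  (* Bounding [gap] by 1 inside [r] produces a square: [(2 + 4 * t) * (2 + 2 * t) + t ^+ 2 = (2 + 3
     * t) ^+ 2]. *)
  have lam_ge : gap * t * (2 + 2 * t) / (2 + 3 * t) ^+ 2 <= lam.
    rewrite ler_pdivlMr//.
    have r_le : r <= (2 + 3 * t) ^+ 2 / ((2 + 4 * t) * (2 + 2 * t)).
      rewrite [leRHS](_ : _ = 1 + t ^+ 2 / ((2 + 4 * t) * (2 + 2 * t))); last first.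
        by field; apply/andP; split; rewrite gt_eqF//; lra.
      rewrite lerD2l ler_wpM2r ?invr_ge0 ?mulr_ge0//; [lra..|].
      by rewrite -[leRHS]mul1r ler_wpM2r ?sqr_ge0.
    apply: (le_trans (ler_wpM2l _ r_le)).
      by rewrite divr_ge0 ?sqr_ge0// !mulr_ge0 ?(ltW t0) ?(ltW gap_gt0)//; lra.
    rewrite le_eqVlt; apply/orP; left; apply/eqP; field.
    by rewrite !gt_eqF//; lra.
  (* Up to the factor [gap * t ^+ 2], the left side is the desired rate plus [delta], and the right
     side is [t] times the lower bound for [lam]. *)
  have key : (2 + t) / ((2 + 4 * t) * (2 + 2 * t)) <= (2 + 2 * t) / (2 + 3 * t) ^+ 2.
    rewrite ler_pdivrMr ?mulr_gt0//; [|lra..].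
    rewrite mulrAC ler_pdivlMr ?exprn_gt0//; [|lra].
    by have := t0; nra.
  have : gap * t ^+ 2 * ((2 + t) / ((2 + 4 * t) * (2 + 2 * t))) <=
      gap * t ^+ 2 * ((2 + 2 * t) / (2 + 3 * t) ^+ 2).
    by rewrite ler_wpM2l// mulr_ge0 ?sqr_ge0// ltW.
  have := ler_wpM2r (ltW t0) lam_ge.
  rewrite [X in X <= _ -> _](_ : _ =
    gap * t ^+ 2 * ((2 + 2 * t) / (2 + 3 * t) ^+ 2)); last by ring.
  rewrite [X in _ -> X <= _ -> _](_ : _ =
    gap * t ^+ 2 / (4 + 8 * t) + delta); last first.
    by rewrite /delta; field; rewrite !gt_eqF//; lra.
  by lra.
pose N := n.+1%:R : R.
have N0 : 0 <= N by exact: ler0n.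
apply: (@le_trans _ _ (path_sum w q n (fun x => (cosh (lam * (N * t)))^-1 *
    cosh (lam * Num.sqrt (\sum_i (\sum_(k < n.+1) (F (x k) i - m i)) ^+ 2))))).
  apply: ler_path_sum => // x; case: (leP (n.+1%:R * t)) => [le_tS|_].
    rewrite mulrC ler_pdivlMr ?cosh_gt0// mul1r.
    apply: ler_cosh; last by rewrite ler_wpM2l.
    by rewrite mulr_ge0// mulr_ge0// ltW.
  by rewrite mulr_ge0// ?invr_ge0 ltW// cosh_gt0.
rewrite path_sumZ; apply: (@le_trans _ _ (2 * expR (- (lam * (N * t))) * r ^+ n.+1)).
  apply: ler_pM.
  - by rewrite invr_ge0 ltW// cosh_gt0.
  - by apply: sumr_ge0 => s _; rewrite mulr_ge0 ?path_weight_ge0// ltW ?cosh_gt0.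
  - rewrite expRN -[leRHS]invf_div lef_pV2 ?posrE ?cosh_gt0 ?divr_gt0 ?expR_gt0//.
    exact: expR_le_cosh.
  - exact: path_sum_cosh_le.
rewrite -mulrA ler_pM2l//.
apply: (@le_trans _ _ (expR (- (lam * (N * t))) * expR (N * delta))).
  rewrite ler_pM2l ?expR_gt0// mulrC expRM_natr lerXn2r ?nnegrE ?expR_ge0 ?(ltW r0)//.
  exact: expR_ge1Dx.
rewrite -expRD ler_expR -[leLHS]opprK lerN2 -subr_ge0.
rewrite [leRHS](_ : _ = N * (lam * t - delta - gap * t ^+ 2 / (4 + 8 * t))).
  by rewrite mulr_ge0// subr_ge0.
by rewrite /N; ring.
Qed.

End ReversibleChain.

(** * Positivity and size of the spectral gap *)

Section SpectralGap.
Context {R : realType} {S : finType} {p : S -> S -> R} {mu : S -> R}.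
Hypothesis p_transition : transition_matrix p.
Hypothesis mu_distribution : distribution_on mu.
Hypothesis p_reversible : reversible mu p.
Implicit Types (h : S -> R).

Let p0 u v : 0 <= p u v. Proof. exact: (p_transition u).1. Qed.
Let mu0 u : 0 <= mu u. Proof. exact: mu_distribution.1. Qed.

(** Both endpoints of a stationary edge have law [mu]. The case [s = -1] gives the Dirichlet form;
    [s = 1] serves in [spectral_gap_le2] and [P2_gap]. *)
Lemma sum_edge_sqr h (s : R) :
  \sum_u \sum_v mu u * p u v * (h u + s * h v) ^+ 2 =
  (1 + s ^+ 2) * dot_mu mu h h + 2 * s * dot_mu mu h (chain_op p h).
Proof.
have h2 : \sum_u \sum_v mu u * p u v * h u ^+ 2 = dot_mu mu h h.
  apply: eq_bigr => u _; rewrite -mulr_suml -mulr_sumr (p_transition u).2.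
  by rewrite mulr1 expr2 mulrA.
have -> : (1 + s ^+ 2) * dot_mu mu h h =
    dot_mu mu h h + s ^+ 2 * \sum_u \sum_v mu u * p u v * h v ^+ 2.
  rewrite exchange_big /= mulrDl mul1r -h2; congr (_ + _ * _).
  by apply: eq_bigr => u _; apply: eq_bigr => v _; rewrite p_reversible.
rewrite -h2 /dot_mu !mulr_sumr -!big_split; apply: eq_bigr => u _ /=.
by rewrite /chain_op !mulr_sumr -!big_split; apply: eq_bigr => v _ /=; ring.
Qed.

Let dirichlet h := dot_mu mu h h - dot_mu mu h (chain_op p h).

Let dirichletE h :
  2 * dirichlet h = \sum_u \sum_v mu u * p u v * (h u - h v) ^+ 2.
Proof.
under eq_bigr do under eq_bigr do rewrite -(mulN1r (h _)).
by rewrite sum_edge_sqr /dirichlet; ring.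
Qed.

Let dirichlet_ge0 h : 0 <= dirichlet h.
Proof.
rewrite -(pmulr_rge0 _ (ltr0n _ 2 : 0 < 2)) dirichletE.
by apply: sumr_ge0 => u _; apply: sumr_ge0 => v _; rewrite mulr_ge0 ?sqr_ge0 ?mulr_ge0//.
Qed.

Hypothesis p_irreducible : irreducible_chain p.

(** Induction along paths of positive probability: a positive entry of a product of nonnegative
    matrices has a positive term. *)
Lemma irreducible_ind (C : S -> S -> Prop) : (forall u, C u u) ->
  (forall u v x, 0 < p u v -> C v x -> C u x) -> forall u v, C u v.
Proof.
move=> Crefl Cstep u v; have [n] := p_irreducible u v.
elim: n u => [|n IH] u.
  rewrite expr0 mxE; case: eqP => [/enum_rank_inj <- _|_]; first exact: Crefl.
  by rewrite ltxx.
rewrite exprS mxE => sum_gt0.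
have [x] : exists x, 0 < p u x * (mx_of p ^+ n) (enum_rank x) (enum_rank v).
  apply: contrapT => /forallNP noedge; move: sum_gt0; rewrite ltNge => /negP; apply.
  apply: sumr_le0 => k _; rewrite mxE enum_rankK -{2}(enum_valK k) leNgt.
  exact/negP/noedge.
move=> pq; have pux : 0 < p u x.
  by rewrite lt_def p0 andbT; apply: contraTneq pq => ->; rewrite mul0r ltxx.
by apply: (Cstep u x) => //; apply: IH; rewrite pmulr_rgt0 in pq.
Qed.

(** Some state has positive mass, and detailed balance carries positivity along edges. *)
Lemma irreducible_distribution_gt0 u : 0 < mu u.
Proof.
have [x mux] : exists x, 0 < mu x.
  apply: contrapT => /forallNP mule; have : (0 : R) < 1 by exact: ltr01.
  rewrite -[X in _ < X]mu_distribution.2 ltNge => /negP; apply; apply: sumr_le0 => x _.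
  by rewrite leNgt; exact/negP/mule.
apply: (irreducible_ind (fun x y => 0 < mu x -> 0 < mu y)) mux => // a b c pab bc mua.
apply: bc; rewrite lt_def mu0 andbT; apply: contraTneq (mulr_gt0 mua pab) => mub.
by rewrite p_reversible mub mul0r ltxx.
Qed.

(** For centred [h] the mean of [(h u - h v) ^+ 2] under the product of [mu] with itself is
    [2 * dot_mu mu h h], so a bound for each pair suffices. *)
Lemma poincare : exists2 C : R, 0 < C &
  forall h, \sum_u mu u * h u = 0 -> dot_mu mu h h <= C * dirichlet h.
Proof.
have : forall uv : S * S, exists C : R, 0 <= C /\
    forall h, (h uv.1 - h uv.2) ^+ 2 <= C * dirichlet h.
  case; apply: irreducible_ind => [u|u v x puv [C [C0 HC]]] /=.
    by exists 0; split => // h; rewrite subrr expr0n mul0r.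
  have muv : 0 < mu u * p u v by rewrite mulr_gt0// irreducible_distribution_gt0.
  (* From [(a + b) ^+ 2 <= 2 * a ^+ 2 + 2 * b ^+ 2]; the first edge is a single term of
     [dirichletE]. *)
  exists (4 / (mu u * p u v) + 2 * C); split.
    by rewrite addr_ge0// ?mulr_ge0// invr_ge0 ltW.
  move=> h; have edge : (h u - h v) ^+ 2 <= 2 / (mu u * p u v) * dirichlet h.
    rewrite mulrAC ler_pdivlMr// dirichletE mulrC (bigD1 u)//= (bigD1 v)//= -addrA.
    rewrite lerDl addr_ge0//.
      by apply: sumr_ge0 => y _; rewrite mulr_ge0 ?sqr_ge0 ?mulr_ge0//.
    by apply: sumr_ge0 => y _; apply: sumr_ge0 => z _; rewrite mulr_ge0 ?sqr_ge0 ?mulr_ge0//.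
  have /= vx := HC h; have := sqr_ge0 ((h u - h v) - (h v - h x)).
  rewrite mulrDl; move: (mu u * p u v)^-1 (dirichlet h) edge vx => M D edge vx.
  by nra.
move=> /choice[C HC].
exists (1 + \sum_u \sum_v mu u * mu v * C (u, v)).
  rewrite ltr_pwDl//; apply: sumr_ge0 => u _; apply: sumr_ge0 => v _.
  by rewrite !mulr_ge0//; exact: (HC _).1.
move=> h h0; have D0 := dirichlet_ge0 h.
have pairE : \sum_u \sum_v mu u * mu v * (h u - h v) ^+ 2 = 2 * dot_mu mu h h.
  have uE : \sum_u \sum_v mu u * mu v * h u ^+ 2 = dot_mu mu h h.
    apply: eq_bigr => u _; rewrite -mulr_suml -mulr_sumr mu_distribution.2.
    by rewrite mulr1 expr2 mulrA.
  have vE : \sum_u \sum_v mu u * mu v * h v ^+ 2 = dot_mu mu h h.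
    rewrite exchange_big -uE; apply: eq_bigr => u _; apply: eq_bigr => v _.
    by rewrite (mulrC (mu v)).
  have uvE : \sum_u \sum_v (mu u * h u) * (mu v * h v) = 0.
    by rewrite -big_distrlr /= h0 mul0r.
  transitivity (\sum_u \sum_v mu u * mu v * h u ^+ 2 +
      \sum_u \sum_v mu u * mu v * h v ^+ 2 -
      2 * \sum_u \sum_v (mu u * h u) * (mu v * h v)); last by rewrite uE vE uvE; ring.
  rewrite mulr_sumr -big_split -sumrB; apply: eq_bigr => u _ /=.
  by rewrite mulr_sumr -big_split -sumrB; apply: eq_bigr => v _ /=; ring.
have : 2 * dot_mu mu h h <= (\sum_u \sum_v mu u * mu v * C (u, v)) * dirichlet h.
  rewrite -pairE mulr_suml; apply: ler_sum => u _.
  rewrite mulr_suml; apply: ler_sum => v _; rewrite -[leRHS]mulrA ler_wpM2l ?mulr_ge0//.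
  exact: (HC (u, v)).2.
by have := dot_mu_ge0 mu h mu0; rewrite mulrDl; lra.
Qed.

Let norm_muE h : norm_mu mu h ^+ 2 = dot_mu mu h h.
Proof. by rewrite sqr_sqrtr// dot_mu_ge0. Qed.

Let dot_mu_gt0 h : h <> cst 0 -> 0 < dot_mu mu h h.
Proof.
move=> hN0; have [u hu] : exists u, h u != 0.
  apply: contrapT => /forallNP h0; apply: hN0; apply/funext => u.
  by have /negP/negPn/eqP := h0 u.
rewrite /dot_mu (bigD1 u)//= ltr_pwDl//.
  by rewrite -mulrA -expr2 mulr_gt0 ?irreducible_distribution_gt0// exprn_even_gt0.
by apply: sumr_ge0 => v _; rewrite -mulrA -expr2 mulr_ge0 ?sqr_ge0.
Qed.

Let ratios := [set dot_mu mu h (chain_op p h) / norm_mu mu h ^+ 2 |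
  h in [set h | \sum_u mu u * h u = 0 /\ h <> cst 0]].

Let ratio_le1 : ubound ratios 1.
Proof.
move=> _ [h [h0 hN0] <-]; rewrite norm_muE ler_pdivrMr ?dot_mu_gt0// mul1r.
by rewrite -subr_ge0; exact: dirichlet_ge0.
Qed.

Let has_ubound_ratios : has_ubound ratios. Proof. by exists 1. Qed.

Lemma spectral_gapP h : \sum_u mu u * h u = 0 ->
  dot_mu mu h (chain_op p h) <= (1 - spectral_gap mu p) * dot_mu mu h h.
Proof.
move=> h0; have [->|hN0] := pselect (h = cst 0).
  by rewrite /dot_mu !big1 ?mulr0// => u _; rewrite /= mulr0 ?mul0r.
rewrite /spectral_gap opprB addrC subrK -ler_pdivrMr ?dot_mu_gt0// -norm_muE.
by apply: ub_le_sup => //; exists h.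
Qed.

Hypothesis card_ge2 : (2 <= #|S|)%N.

Let ratios_neq0 : ratios !=set0.
Proof.
have /card_gt1P[u [v [_ _ uv]]] : (1 < #|[pred u : S | true]|)%N by [].
(* The difference of the densities of two point masses with respect to [mu]. *)
pose h x := (x == u)%:R / mu u - (x == v)%:R / mu v.
exists (dot_mu mu h (chain_op p h) / norm_mu mu h ^+ 2), h => //; split.
  have mean1 y : \sum_x mu x * ((x == y)%:R / mu y) = 1.
    rewrite (bigD1 y)//= eqxx mul1r divff ?gt_eqF ?irreducible_distribution_gt0//.
    by rewrite big1 ?addr0// => x /negPf->; rewrite mul0r mulr0.
  by rewrite /h; under eq_bigr do rewrite mulrBr; rewrite sumrB !mean1 subrr.
move=> /(congr1 (fun f => f u)); rewrite /h /= eqxx (negPf uv) mul0r subr0 mul1r.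
by apply/eqP; rewrite invr_eq0 gt_eqF// irreducible_distribution_gt0.
Qed.

Lemma spectral_gap_gt0 : 0 < spectral_gap mu p.
Proof.
have [C C0 HC] := poincare.
have : sup ratios <= 1 - C^-1.
  apply: ge_sup => // _ [h [h0 hN0] <-]; rewrite norm_muE ler_pdivrMr ?dot_mu_gt0//.
  rewrite mulrBl mul1r lerBrDr -lerBrDl -ler_pdivlMl ?invr_gt0// invrK.
  exact: HC.
have : 0 < C^-1 by rewrite invr_gt0.
by rewrite /spectral_gap -/ratios; lra.
Qed.

(** Every Rayleigh quotient is at least -1. This makes [eta / 2] an admissible gap, at most 1. *)
Lemma spectral_gap_le2 : spectral_gap mu p <= 2.
Proof.
have [_ [h [h0 hN0] _]] := ratios_neq0.
have : dot_mu mu h (chain_op p h) / norm_mu mu h ^+ 2 <= sup ratios.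
  by apply: ub_le_sup => //; exists h.
have : -1 <= dot_mu mu h (chain_op p h) / norm_mu mu h ^+ 2.
  rewrite norm_muE ler_pdivlMr ?dot_mu_gt0//.
  have : 0 <= \sum_u \sum_v mu u * p u v * (h u + 1 * h v) ^+ 2.
    by apply: sumr_ge0 => u _; apply: sumr_ge0 => v _; rewrite mulr_ge0 ?sqr_ge0 ?mulr_ge0//.
  by rewrite sum_edge_sqr; lra.
by rewrite /spectral_gap -/ratios; lra.
Qed.

End SpectralGap.

(** * The chain on unordered pairs *)

Section SymmetricPairChain.
Context {R : realType} {S : finType} {p : S -> S -> R} {mu : S -> R}.
Implicit Types (h k : sym_pairs S -> R).

Lemma clsC (u v : S) : cls u v = cls v u.
Proof. by apply/eqP/clsP; right. Qed.

(** Lifts sums over classes to ordered edges. *)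
Lemma sum_pair_law (nu : S -> R) h :
  \sum_q pair_law nu p q * h q = \sum_u \sum_v nu u * p u v * h (cls u v).
Proof.
rewrite pair_bigA (partition_big (fun x : S * S => cls x.1 x.2) predT)//=.
apply: eq_bigr => q _; rewrite /pair_law mulr_suml.
by apply: eq_bigr => x /eqP <-.
Qed.

Let psi h u := \sum_v p u v * h (cls u v).

Lemma chain_op_P2 h u v :
  chain_op (P2 p) h (cls u v) = 2^-1 * psi h v + 2^-1 * psi h u.
Proof.
have sum_cls x : \sum_q (\sum_(y | cls x y == q) p x y) * h q = psi h x.
  rewrite /psi (partition_big (fun y : S => cls x y) predT)//=.
  by apply: eq_bigr => q _; rewrite mulr_suml; apply: eq_bigr => y /eqP <-.
rewrite /chain_op; under eq_bigr do rewrite P2_cls /jump mulrDl -!mulrA.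
by rewrite big_split /= -!mulr_sumr !sum_cls.
Qed.

Hypothesis p_transition : transition_matrix p.

Lemma P2_transition : transition_matrix (P2 p).
Proof.
move=> q; split=> [q'|].
  rewrite /P2 /jump addr_ge0// mulr_ge0 ?invr_ge0// sumr_ge0// => v _.
  - exact: (p_transition _).1.
  - exact: (p_transition _).1.
have := chain_op_P2 (fun=> 1) (repr q).1 (repr q).2; rewrite cls_repr /chain_op /psi.
under eq_bigr do rewrite mulr1; move=> ->.
under eq_bigr do rewrite mulr1; under [X in _ + _ * X]eq_bigr do rewrite mulr1.
by rewrite !(p_transition _).2; field.
Qed.

Lemma pair_law_distribution (nu : S -> R) :
  distribution_on nu -> distribution_on (pair_law nu p).
Proof.
move=> nu_dist; split=> [q|].
  by apply: sumr_ge0 => x _; rewrite mulr_ge0// ?nu_dist.1//; exact: (p_transition _).1.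
have := sum_pair_law nu (fun=> 1); under eq_bigr do rewrite mulr1; move=> ->.
rewrite -[RHS]nu_dist.2; apply: eq_bigr => u _.
under eq_bigr do rewrite mulr1.
by rewrite -mulr_sumr (p_transition u).2 mulr1.
Qed.

Hypothesis p_reversible : reversible mu p.

(** Stationary edges are symmetric in law, so [f] may be evaluated at the first endpoint alone;
    conditioning on that endpoint turns [h] into [psi h]. *)
Lemma sum_edge_sym (f : S -> R) h :
  \sum_u \sum_v mu u * p u v * (h (cls u v) * (2^-1 * f v + 2^-1 * f u)) =
  dot_mu mu (psi h) f.
Proof.
have fu : \sum_u \sum_v mu u * p u v * (h (cls u v) * f u) = dot_mu mu (psi h) f.
  apply: eq_bigr => u _; rewrite /psi mulr_sumr mulr_suml.
  by apply: eq_bigr => v _; ring.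
have fv : \sum_u \sum_v mu u * p u v * (h (cls u v) * f v) = dot_mu mu (psi h) f.
  rewrite exchange_big -fu; apply: eq_bigr => u _; apply: eq_bigr => v _.
  by rewrite p_reversible clsC.
transitivity (2^-1 * dot_mu mu (psi h) f + 2^-1 * dot_mu mu (psi h) f); last by field.
rewrite -{1}fv -fu !mulr_sumr -big_split; apply: eq_bigr => u _ /=.
by rewrite !mulr_sumr -big_split; apply: eq_bigr => v _ /=; ring.
Qed.

Lemma dot_mu_P2 h k :
  dot_mu (pair_law mu p) h (chain_op (P2 p) k) = dot_mu mu (psi h) (psi k).
Proof.
rewrite -sum_edge_sym /dot_mu; under eq_bigr do rewrite -mulrA.
rewrite sum_pair_law; apply: eq_bigr => u _; apply: eq_bigr => v _.
by rewrite chain_op_P2.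
Qed.

(** The form in [dot_mu_P2] is symmetric; detailed balance is its value on indicators. *)
Lemma P2_reversible : reversible (pair_law mu p) (P2 p).
Proof.
have P2E q q' : dot_mu (pair_law mu p) (fun x => (x == q)%:R)
    (chain_op (P2 p) (fun x => (x == q')%:R)) = pair_law mu p q * P2 p q q'.
  rewrite /dot_mu (bigD1 q)//= eqxx mulr1 big1 ?addr0; last first.
    by move=> x /negPf->; rewrite mulr0 mul0r.
  rewrite /chain_op (bigD1 q')//= eqxx mulr1 big1 ?addr0// => x /negPf->.
  by rewrite mulr0.
by move=> q q'; rewrite -!P2E !dot_mu_P2 dot_muC.
Qed.

Hypothesis mu_distribution : distribution_on mu.

Let mu0 u : 0 <= mu u. Proof. exact: mu_distribution.1. Qed.

Lemma P2_ge0 h : 0 <= dot_mu (pair_law mu p) h (chain_op (P2 p) h).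
Proof. by rewrite dot_mu_P2 dot_mu_ge0. Qed.

Lemma P2_gap (eta : R) : eta <= 2 ->
  (forall f : S -> R, \sum_u mu u * f u = 0 ->
     dot_mu mu f (chain_op p f) <= (1 - eta) * dot_mu mu f f) ->
  forall h, \sum_q pair_law mu p q * h q = 0 ->
    dot_mu (pair_law mu p) h (chain_op (P2 p) h) <=
    (1 - eta / 2) * dot_mu (pair_law mu p) h h.
Proof.
move=> eta2 gapP h h0; rewrite dot_mu_P2.
set f := psi h; pose a := dot_mu mu f f.
have f0 : \sum_u mu u * f u = 0.
  rewrite -[RHS]h0 sum_pair_law; apply: eq_bigr => u _.
  by rewrite mulr_sumr; apply: eq_bigr => v _; rewrite mulrA.
(* Cauchy-Schwarz is applied on ordered edges to the lift [H] of [h] and the endpoint average [A] of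
   [f]. It gives [a ^+ 2] at most [(1 - eta / 2) * a] times the squared norm of [h], and [a] is
   cancelled. *)
pose w (x : S * S) := mu x.1 * p x.1 x.2.
have w0 x : 0 <= w x by rewrite mulr_ge0//; exact: (p_transition _).1.
pose H (x : S * S) := h (cls x.1 x.2).
pose A (x : S * S) := 2^-1 * f x.2 + 2^-1 * f x.1.
have HA : dot_mu w H A = a.
  rewrite /a -sum_edge_sym pair_bigA; apply: eq_bigr => x _.
  by rewrite /w /H /A mulrA.
have HH : dot_mu w H H = dot_mu (pair_law mu p) h h.
  rewrite /dot_mu; under [RHS]eq_bigr do rewrite -mulrA.
  by rewrite sum_pair_law pair_bigA; apply: eq_bigr => x _; rewrite -mulrA.
have AA : dot_mu w A A <= (1 - eta / 2) * a.
  have -> : dot_mu w A A =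
      4^-1 * \sum_u \sum_v mu u * p u v * (f u + 1 * f v) ^+ 2.
    by rewrite pair_bigA mulr_sumr; apply: eq_bigr => x _; rewrite /w /A; field.
  rewrite (sum_edge_sqr p_transition p_reversible); have := gapP f f0; rewrite -/a; lra.
have a0 : 0 <= a by exact: dot_mu_ge0.
have := cauchy_schwarz w H A w0; rewrite HA HH -/a.
have H0 : 0 <= dot_mu (pair_law mu p) h h by rewrite -HH dot_mu_ge0.
have c0 : 0 <= 1 - eta / 2 by lra.
move=> cs; have := le_trans cs (ler_wpM2l H0 AA).
have [->|aN0] := eqVneq a 0; first by rewrite mulr_ge0.
have a_gt0 : 0 < a by rewrite lt_def aN0.
by rewrite mulrA expr2 ler_pM2r// (mulrC (dot_mu _ _ _)).
Qed.

End SymmetricPairChain.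

(** * The symmetrised matrix units and their mean *)

Section SymmetricPairMatrix.
Context {R : realType} {S : finType}.

Lemma F2_sym (q : sym_pairs S) : (F2 q)^T = F2 q :> 'M[R]_#|S|.
Proof. by rewrite /F2 linearZ linearD /= /Emx !trmx_delta addrC. Qed.

Lemma sum_F2_le1 (q : sym_pairs S) :
  \sum_ij `|(F2 q : 'M[R]_#|S|) ij.1 ij.2| <= 1.
Proof.
have E1 (u v : S) : \sum_(ij : 'I_#|S| * 'I_#|S|) (Emx u v : 'M[R]_#|S|) ij.1 ij.2 = 1.
  rewrite (bigD1 (enum_rank u, enum_rank v))//= mxE !eqxx big1 ?addr0// => -[i j].
  by rewrite xpair_eqE mxE => /negPf->.
rewrite [leLHS](_ : _ = 2^-1 * (\sum_ij (Emx (repr q).1 (repr q).2) ij.1 ij.2 +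
    \sum_ij (Emx (repr q).2 (repr q).1) ij.1 ij.2)).
  by rewrite !E1; lra.
rewrite -big_split mulr_sumr; apply: eq_bigr => ij _ /=.
by rewrite !mxE ger0_norm// mulr_ge0 ?invr_ge0// addr_ge0.
Qed.

(** By reversibility the two halves of [F2] have the same mean. *)
Lemma mean_F2 (p : S -> S -> R) (mu : S -> R) : reversible mu p ->
  forall i j, \sum_q pair_law mu p q * (F2 q : 'M[R]_#|S|) i j =
    (dmx_of mu *m mx_of p) i j.
Proof.
move=> rev i j; rewrite (sum_pair_law (p := p) mu (fun q => (F2 q : 'M[R]_#|S|) i j)).
pose e (u v : S) : R := (i == enum_rank u)%:R * (j == enum_rank v)%:R.
have eE f : \sum_u \sum_v f u v * e u v = f (enum_val i) (enum_val j) :> R.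
  rewrite (bigD1 (enum_val i))//= (bigD1 (enum_val j))//= /e !enum_valK !eqxx !mulr1.
  rewrite big1 => [|v vj]; last first.
    by rewrite -(can2_eq enum_valK enum_rankK) eq_sym (negPf vj) !mulr0.
  rewrite big1 ?addr0// => u ui; rewrite big1// => v _.
  by rewrite -(can2_eq enum_valK enum_rankK) eq_sym (negPf ui) mul0r mulr0.
transitivity (2^-1 * (\sum_u \sum_v mu u * p u v * e u v) +
    2^-1 * (\sum_u \sum_v mu u * p u v * e v u)).
  rewrite !mulr_sumr -big_split; apply: eq_bigr => u _ /=.
  rewrite !mulr_sumr -big_split; apply: eq_bigr => v _ /=.
  by rewrite F2_cls !mxE -!mulnb !natrM /e; ring.
have -> : \sum_u \sum_v mu u * p u v * e v u = \sum_u \sum_v mu u * p u v * e u v.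
  rewrite exchange_big; apply: eq_bigr => u _; apply: eq_bigr => v _.
  by rewrite rev.
by rewrite eE mul_diag_mx !mxE; field.
Qed.

End SymmetricPairMatrix.

(** * From the probability space to path sums *)

Section MarkovChainLaw.
Context {R : realType} {disp : measure_display} {T : measurableType disp}.
Context {S : finType} {Pr : probability T R} {X : nat -> T -> S}.
Context {init : S -> R} {q : S -> S -> R}.
Hypothesis X_chain : markov_chain Pr X init q.

Let cylinder n (s : nat -> S) := [set w | forall i, (i <= n)%N -> X i w = s i].

Lemma measurable_cylinder n s : measurable (cylinder n s).
Proof.
have [X_meas _ _] := X_chain; elim: n => [|n IH].
  rewrite (_ : cylinder 0 s = [set w | X 0%N w = s 0%N])//.
  by apply/seteqP; split=> w /= H; [exact: H|move=> [|]//].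
rewrite (_ : cylinder n.+1 s = cylinder n s `&` [set w | X n.+1 w = s n.+1]).
  exact: measurableI.
apply/seteqP; split=> w /=.
  by move=> H; split=> [i /leqW|]; apply: H.
by move=> [H Hn] i; rewrite leq_eqVlt => /predU1P[->//|]; exact: H.
Qed.

Lemma markov_chain_cylinder n s : Pr (cylinder n s) = (path_weight init q n s)%:E.
Proof.
have [_ X_init X_step] := X_chain; elim: n => [|n IH].
  rewrite /path_weight big_ord0 mulr1 -X_init; congr (Pr _).
  by apply/seteqP; split=> w /= H; [exact: H|move=> [|]//].
rewrite X_step -/(cylinder n s) IH -EFinM; congr EFin.
by rewrite /path_weight big_ord_recr /= mulrA.
Qed.

(** A functional of the first [n.+1] states is a simple function on cylinders, which yields its
    integral. *)
Lemma markov_chain_functional n (Phi : (nat -> S) -> R) w :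
  (forall x y, (forall i, (i <= n)%N -> x i = y i) -> Phi x = Phi y) ->
  Phi (X ^~ w) = \sum_(s : {ffun 'I_n.+1 -> S})
    Phi (path_of n s) * \1_(cylinder n (path_of n s)) w.
Proof.
move=> Phi_local; pose sw : {ffun 'I_n.+1 -> S} := [ffun i : 'I_n.+1 => X i w].
have swE i : (i <= n)%N -> path_of n sw i = X i w.
  by move=> le_in; rewrite /path_of ffunE (minn_idPl le_in) inordK.
rewrite (bigD1 sw)//= big1 ?addr0 => [|s s_neq].
  rewrite indicE mem_set ?mulr1; first by apply: Phi_local => i /swE ->.
  by move=> i /swE ->.
rewrite indicE memNset ?mulr0// => /= Xs; move/eqP: s_neq; apply.
apply/ffunP => i; have le_in : (i <= n)%N by rewrite -ltnS.
by rewrite ffunE Xs// /path_of (minn_idPl le_in) inord_val.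
Qed.

Lemma markov_chain_integral n (Phi : (nat -> S) -> R) :
  (forall x y, (forall i, (i <= n)%N -> x i = y i) -> Phi x = Phi y) ->
  (forall x, 0 <= Phi x) ->
  (\int[Pr]_w (Phi (X ^~ w))%:E = (path_sum init q n Phi)%:E)%E.
Proof.
move=> Phi_local Phi0.
under eq_integral do rewrite (markov_chain_functional _ _ _ Phi_local) -sumEFin.
rewrite ge0_integral_sum//=; last 2 first.
- move=> s; apply/measurable_EFinP/measurable_funM => //.
  exact/measurable_indic/measurable_cylinder.
- by move=> s w _; rewrite lee_fin mulr_ge0.
rewrite /path_sum -sumEFin; apply: eq_bigr => s _.
under eq_integral do rewrite EFinM.
rewrite ge0_integralZl//=; last 2 first.
- exact/measurable_EFinP/measurable_indic/measurable_cylinder.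
- by rewrite lee_fin.
rewrite integral_indic ?setIT//; last exact: measurable_cylinder.
transitivity ((Phi (path_of n s))%:E * (path_weight init q n (path_of n s))%:E)%E.
  by congr (_ * _)%E; exact: markov_chain_cylinder.
by rewrite -EFinM mulrC.
Qed.

Lemma measurable_markov_chain_event n (B : (nat -> S) -> bool) :
  (forall x y, (forall i, (i <= n)%N -> x i = y i) -> B x = B y) ->
  measurable [set w | B (X ^~ w)].
Proof.
move=> B_local.
have mem_cylinder w (s : {ffun 'I_n.+1 -> S}) :
    cylinder n (path_of n s) w -> B (X ^~ w) = B (path_of n s).
  by move=> Xs; apply: B_local => i /Xs.
rewrite (_ : [set w | _] =
    \bigcup_(s in [set s : {ffun 'I_n.+1 -> S} | B (path_of n s)])
      cylinder n (path_of n s)).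
  apply: fin_bigcup_measurable => [|s _]; last exact: measurable_cylinder.
  exact: finite_finset.
apply/seteqP; split=> [w /= Bw|w [s /= Bs /mem_cylinder]]; last by rewrite Bs => ->.
have Xs : cylinder n (path_of n [ffun i : 'I_n.+1 => X i w]) w.
  by move=> i le_in; rewrite /path_of ffunE (minn_idPl le_in) inordK.
by exists [ffun i : 'I_n.+1 => X i w] => //=; rewrite -(mem_cylinder w).
Qed.

Lemma markov_chain_event n (B : (nat -> S) -> bool) :
  (forall x y, (forall i, (i <= n)%N -> x i = y i) -> B x = B y) ->
  Pr [set w | B (X ^~ w)] = (path_sum init q n (fun x => (B x)%:R))%:E.
Proof.
move=> B_local; rewrite -markov_chain_integral => [|x y /B_local->//|//].
rewrite -[X in Pr X]setIT -integral_indic//; last exact: measurable_markov_chain_event B_local.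
apply: eq_integral => w _; rewrite indicE; congr ((nat_of_bool _)%:R%:E).
by apply/idP/idP; rewrite inE.
Qed.

End MarkovChainLaw.

(** * Frobenius norm and operator norm *)

Section FrobeniusNorm.
Context {R : realType}.

Lemma frobenius_norm_pair m n (A : 'M[R]_(m, n)) :
  frobenius_norm A = Num.sqrt (\sum_ij A ij.1 ij.2 ^+ 2).
Proof. by rewrite /frobenius_norm pair_bigA. Qed.

Lemma frobenius_norm_ge m n (A : 'M[R]_(m, n)) i j : `|A i j| <= frobenius_norm A.
Proof.
rewrite frobenius_norm_pair -sqrtr_sqr ler_wsqrtr// (bigD1 (i, j))//= lerDl.
by apply: sumr_ge0 => ij _; rewrite sqr_ge0.
Qed.

(** Cauchy-Schwarz in each row, with unit weights. *)
Lemma op_norm_le_frobenius n (A : 'M[R]_n) : op_norm A <= frobenius_norm A.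
Proof.
apply: ge_sup => [|_ [x x1 <-]].
  exists (l2_norm (A *m 0)), 0 => //=; rewrite /l2_norm big1 ?sqrtr0// => i _.
  by rewrite mxE expr0n.
have x2 : \sum_i x i 0 ^+ 2 <= 1.
  have s0 : 0 <= \sum_i x i 0 ^+ 2 by apply: sumr_ge0 => i _; exact: sqr_ge0.
  by rewrite -(sqr_sqrtr s0) exprn_ile1 ?sqrtr_ge0.
rewrite ler_wsqrtr//; apply: ler_sum => i _.
have := cauchy_schwarz (fun=> 1) (A i) (x ^~ 0) (fun=> ler01).
have dotE (h k : 'I_n -> R) : dot_mu (fun=> 1) h k = \sum_j h j * k j.
  by apply: eq_bigr => j _; rewrite mul1r.
have sqrE (h : 'I_n -> R) : dot_mu (fun=> 1) h h = \sum_j h j ^+ 2.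
  by rewrite dotE; apply: eq_bigr => j _; rewrite expr2.
rewrite !sqrE dotE mxE => /le_trans; apply.
by rewrite ler_piMr// sumr_ge0// => j _; exact: sqr_ge0.
Qed.

Lemma frobenius_Hmx (S : finType) n (x : nat -> sym_pairs S) (M : 'M[R]_#|S|) :
  frobenius_norm (Hmx (fun k y => y k) n.+1 x - M) =
  n.+1%:R^-1 * Num.sqrt (\sum_ij
    (\sum_(k < n.+1) (F2 (x k) ij.1 ij.2 - M ij.1 ij.2)) ^+ 2).
Proof.
have N0 : 0 <= n.+1%:R^-1 :> R by rewrite invr_ge0.
rewrite frobenius_norm_pair -{1}(ger0_norm N0) -sqrtr_sqr -sqrtrM ?sqr_ge0//.
rewrite mulr_sumr; congr Num.sqrt; apply: eq_bigr => ij _.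
rewrite -exprMn; congr (_ ^+ 2).
rewrite !mxE summxE sumrB sumr_const card_ord -(mulr_natl (M _ _)) mulrBr (mulrA _ _ (M _ _)).
by rewrite mulVf ?mul1r ?pnatr_eq0.
Qed.

End FrobeniusNorm.

(** * Concentration of the empirical matrix and almost sure convergence *)

Section Concentration.
Context {R : realType} {S : finType} {p : S -> S -> R} {mu nu : S -> R}.
Context {disp : measure_display} {T : measurableType disp} {Pr : probability T R}.
Context {U : nat -> T -> sym_pairs S}.
Hypothesis card_ge2 : (2 <= #|S|)%N.
Hypothesis p_transition : transition_matrix p.
Hypothesis p_irreducible : irreducible_chain p.
Hypothesis mu_distribution : distribution_on mu.
Hypothesis p_reversible : reversible mu p.
Hypothesis nu_distribution : distribution_on nu.
Hypothesis U_chain : markov_chain Pr U (pair_law nu p) (P2 p).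

Let eta := spectral_gap mu p.
Let M := dmx_of mu *m mx_of p.
Let ratio := ratio_norm nu mu.
(** The coordinate process is used here, so that [H n] is a functional of the path itself. *)
Let H n (x : nat -> sym_pairs S) : 'M[R]_#|S| := Hmx (fun k y => y k) n x.

Let eta_gt0 : 0 < eta. Proof. exact: spectral_gap_gt0. Qed.
Let eta_le2 : eta <= 2. Proof. exact: spectral_gap_le2. Qed.
Let gap_gt0 : 0 < eta / 2. Proof. by rewrite divr_gt0. Qed.
Let gap_le1 : eta / 2 <= 1. Proof. by rewrite ler_pdivrMr// mul1r. Qed.

Lemma ratio_norm_ge0 : 0 <= ratio.
Proof. exact: bigmax_ge_id. Qed.

Lemma pair_law_le_ratio q : pair_law nu p q <= ratio * pair_law mu p q.
Proof.
rewrite mulr_sumr; apply: ler_sum => x _; rewrite mulrA ler_wpM2r//.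
  exact: (p_transition _).1.
rewrite -ler_pdivrMr ?(irreducible_distribution_gt0 (p := p))//.
exact: (le_bigmax _ (fun u => nu u / mu u)).
Qed.

Lemma local_H n (f : 'M[R]_#|S| -> R) x y :
  (forall i, (i <= n)%N -> x i = y i) -> f (H n.+1 x) = f (H n.+1 y).
Proof.
move=> xy; congr f; congr (_ *: _); apply: eq_bigr => k _.
by rewrite xy// -ltnS.
Qed.

Let P2_path_sum n Phi : (forall x, 0 <= Phi x) ->
  path_sum (pair_law nu p) (P2 p) n Phi <=
  ratio * path_sum (pair_law mu p) (P2 p) n Phi.
Proof.
move=> Phi0; apply: ler_path_sum_init => //; first exact: P2_transition.
exact: pair_law_le_ratio.
Qed.

Let F (q : sym_pairs S) (ij : 'I_#|S| * 'I_#|S|) : R := F2 q ij.1 ij.2.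

Let meanF ij : \sum_q pair_law mu p q * F q ij = M ij.1 ij.2.
Proof. exact: mean_F2. Qed.

Lemma frobenius_path_tail n t : 0 < t ->
  path_sum (pair_law nu p) (P2 p) n
    (fun x => (t <= frobenius_norm (H n.+1 x - M))%R%:R) <=
  2 * ratio * expR (- (n.+1%:R * (eta / 2 * t ^+ 2 / (4 + 8 * t)))).
Proof.
move=> t0; apply: (le_trans (P2_path_sum _ _ _)) => //.
set e := expR _; rewrite (_ : 2 * ratio * e = ratio * (2 * e)); last by ring.
apply: ler_wpM2l; first exact: ratio_norm_ge0.
have := path_sum_tail_le (w := pair_law mu p) (q := P2 p) (gap := eta / 2)
  (pair_law_distribution p_transition _ mu_distribution) (P2_transition p_transition)
  (P2_reversible p_reversible) (P2_ge0 p_reversible mu_distribution)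
  (P2_gap p_transition p_reversible mu_distribution _ eta_le2
    (spectral_gapP p_transition mu_distribution p_reversible p_irreducible))
  gap_gt0 gap_le1 _ F n t sum_F2_le1 t0.
apply: le_trans; rewrite le_eqVlt; apply/orP; left; apply/eqP/eq_path_sum => x.
congr ((nat_of_bool _)%:R); rewrite frobenius_Hmx mulrC ler_pdivlMr// mulrC.
congr (_ <= Num.sqrt _); apply: eq_bigr => ij _; congr (_ ^+ 2).
by apply: eq_bigr => k _; rewrite meanF.
Qed.

Lemma frobenius_tail n t : 0 < t ->
  (Pr [set w | (t <= frobenius_norm (Hmx U n.+1 w - M))%R] <=
   (2 * ratio * expR (- (n.+1%:R * (eta / 2 * t ^+ 2 / (4 + 8 * t)))))%:E)%E.
Proof.
move=> t0; have := markov_chain_event U_chain n (fun x => t <= frobenius_norm (H n.+1 x - M))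
  (fun x y xy => congr1 _ (local_H n (fun A => frobenius_norm (A - M)) x y xy)).
move=> ->; rewrite lee_fin; exact: frobenius_path_tail.
Qed.

Lemma op_norm_tail n t : 0 < t ->
  (Pr [set w | (t <= op_norm (Hmx U n.+1 w - M))%R] <=
   (2 * ratio * expR (- (n.+1%:R * (eta / 2 * t ^+ 2 / (4 + 8 * t)))))%:E)%E.
Proof.
move=> t0; have := markov_chain_event U_chain n (fun x => t <= op_norm (H n.+1 x - M))
  (fun x y xy => congr1 _ (local_H n (fun A => op_norm (A - M)) x y xy)).
move=> ->; rewrite lee_fin; apply: le_trans (frobenius_path_tail n t t0).
apply: ler_path_sum => [|u|x]; first exact: P2_transition.
  exact: (pair_law_distribution p_transition _ nu_distribution).1.
case: (leP t (op_norm _)) => [t_le|_]; last exact: ler0n.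
by rewrite (le_trans t_le)// op_norm_le_frobenius.
Qed.

Lemma frobenius_mean_sqr n :
  ('E_Pr [(fun w => frobenius_norm (Hmx U n.+1 w - M) ^+ 2)%R] <=
   (ratio * ((4 - eta) / (n.+1%:R * eta)))%:E)%E.
Proof.
rewrite unlock.
have := markov_chain_integral U_chain n (fun x => frobenius_norm (H n.+1 x - M) ^+ 2)
  (local_H n (fun A => frobenius_norm (A - M) ^+ 2)) (fun=> sqr_ge0 _).
move=> ->; rewrite lee_fin; apply: (le_trans (P2_path_sum _ _ _)) => [x|].
  exact: sqr_ge0.
rewrite ler_wpM2l ?ratio_norm_ge0//.
have := path_sum_sqr_norm_le (w := pair_law mu p) (q := P2 p) (gap := eta / 2)
  (pair_law_distribution p_transition _ mu_distribution) (P2_transition p_transition)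
  (P2_reversible p_reversible) (P2_ge0 p_reversible mu_distribution)
  (P2_gap p_transition p_reversible mu_distribution _ eta_le2
    (spectral_gapP p_transition mu_distribution p_reversible p_irreducible))
  gap_gt0 gap_le1 _ F n sum_F2_le1.
set N : R := n.+1%:R; have N0 : 0 < N by rewrite ltr0n.
have N2 : 0 <= N ^- 2 by rewrite invr_ge0 sqr_ge0.
move=> /(ler_wpM2l N2); rewrite -path_sumZ.
(* The variance factor at [gap = eta / 2], with the square of the averaging factor. *)
have -> : N ^- 2 * (N * ((2 - eta / 2) / (eta / 2))) = (4 - eta) / (N * eta).
  by field; rewrite !gt_eqF.
apply: le_trans; rewrite le_eqVlt; apply/orP; left; apply/eqP/eq_path_sum => x.
rewrite frobenius_Hmx exprMn exprVn sqr_sqrtr ?sumr_ge0// => [|ij _]; last exact: sqr_ge0.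
congr (_ * _); apply: eq_bigr => ij _; congr (_ ^+ 2).
by apply: eq_bigr => k _; rewrite meanF.
Qed.

(** For fixed [t] the tail bound is geometric in [n], with ratio [rho < 1]. *)
Lemma frobenius_summable t : 0 < t ->
  (\sum_(n <oo) Pr [set w | (t <= frobenius_norm (Hmx U n.+1 w - M))%R] < +oo)%E.
Proof.
move=> t0; pose rho := expR (- (eta / 2 * t ^+ 2 / (4 + 8 * t))).
have rho_lt1 : rho < 1.
  rewrite -[ltRHS]expR0 ltr_expR oppr_lt0 divr_gt0 ?mulr_gt0 ?exprn_gt0//.
  by rewrite addr_gt0// mulr_gt0.
have rho_ge0 : 0 <= rho by exact: expR_ge0.
pose C := 2 * ratio; have C0 : 0 <= C by rewrite mulr_ge0 ?ratio_norm_ge0.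
have tail n : (Pr [set w | (t <= frobenius_norm (Hmx U n.+1 w - M))%R] <=
    (C * rho ^+ n)%:E)%E.
  apply: (le_trans (frobenius_tail n t t0)); rewrite lee_fin ler_wpM2l//.
  rewrite -mulrN mulrC expRM_natr exprSr -[leRHS]mulr1.
  by rewrite ler_wpM2l ?exprn_ge0// ltW.
apply: (@le_lt_trans _ _ (C / (1 - rho))%:E); last exact: ltry.
apply: lime_le; first by apply: is_cvg_nneseries => n _ _; exact: measure_ge0.
apply: nearW => n; apply: (@le_trans _ _ (\sum_(0 <= k < n) (C * rho ^+ k)%:E)%E).
  by apply: lee_sum => k _; exact: tail.
rewrite sumEFin lee_fin -mulr_sumr ler_wpM2l//.
rewrite -[leRHS]mul1r ler_pdivlMr ?subr_gt0// big_mkord.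
have -> : (\sum_(k < n) rho ^+ k) * (1 - rho) = 1 - rho ^+ n.
  by rewrite -[1 in RHS](expr1n _ n) subrXX mulrC; congr (_ * _);
    apply: eq_bigr => k _; rewrite expr1n mul1r.
by rewrite gerBl exprn_ge0.
Qed.

(** Borel-Cantelli for the countably many thresholds [t m], which tend to 0; the Frobenius norm
    controls each entry. *)
Lemma Hmx_cvg : {ae Pr, forall w : T, (fun n => Hmx U n w) @ \oo --> M}.
Proof.
pose t m : R := m.+1%:R^-1.
have t0 m : 0 < t m by rewrite invr_gt0.
pose E m n := [set w | (t m <= frobenius_norm (Hmx U n.+1 w - M))%R].
have E_meas m n : measurable (E m n).
  exact: (measurable_markov_chain_event U_chain n
    (fun x => t m <= frobenius_norm (H n.+1 x - M))
    (fun x y xy => congr1 _ (local_H n (fun A => frobenius_norm (A - M)) x y xy))).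
have : {ae Pr, forall w : T, forall m, ~ lim_sup_set (E m) w}.
  apply: ae_foralln => m; exists (lim_sup_set (E m)); split.
  - apply: bigcapT_measurable => n; apply: bigcup_measurable => k _; exact: E_meas.
  - by apply: lim_sup_set_cvg0 => //; exact: frobenius_summable.
  - by move=> w /= /contrapT.
apply: filterS => w notE; apply/cvg_ballP => e e0.
have [m me] : exists m, t m < e.
  by have [m me] := ltr_add_invr e0; exists m; move: me; rewrite add0r.
have [n nE] : exists n, forall k, (n <= k)%N -> ~ E m k w.
  apply: contrapT => /forallNP H1; apply: (notE m) => n _.
  have /existsNP[k /not_implyP[nk /contrapT Ek]] := H1 n.
  by exists k.
(* The event [E m k] concerns the average of [k.+1] states, hence the shift. *)
exists n.+1 => // -[//|k] /= nk.
split => // i j; rewrite /ball /=.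
have /negP := nE k nk; rewrite -ltNge => frob_lt.
apply: le_lt_trans (lt_trans frob_lt me); rewrite distrC.
by have := frobenius_norm_ge _ _ (Hmx U k.+1 w - M) i j; rewrite mxE [X in _ + X]mxE.
Qed.

End Concentration.

(** * Assembly, with comparison of the constants *)

Theorem theorem2p2 (R : realType) (Omega : finType)
    (p : Omega -> Omega -> R) (mu nu : Omega -> R)
    (disp : measure_display) (T : measurableType disp) (Pr : probability T R)
    (U : nat -> T -> sym_pairs Omega)
    (card_ge2 : (2 <= #|Omega|)%N)
    (p_transition : transition_matrix p)
    (p_irreducible : irreducible_chain p)
    (mu_distribution : distribution_on mu)
    (mu_invariant : invariant_measure mu p)
    (p_reversible : reversible mu p)
    (nu_distribution : distribution_on nu)
    (U_chain : markov_chain Pr U (pair_law nu p) (P2 p)) :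
  [/\ [/\ [/\ transition_matrix (P2 p), distribution_on (pair_law mu p)
            & reversible (pair_law mu p) (P2 p)],
          (forall (n : nat) (w : T), (0 < n)%N ->
             (Hmx U n w)^T = Hmx U n w :> 'M[R]_#|Omega|)
        & {ae Pr, forall w : T,
             (fun n => Hmx U n w) @ \oo --> dmx_of mu *m mx_of p}],
      (forall (n : nat) (t : R), (0 < n)%N -> 0 < t ->
         (Pr [set w | (t <= op_norm (Hmx U n w - dmx_of mu *m mx_of p))%R] <=
          (2 * ratio_norm nu mu * #|Omega|%:R `^ (2 - pi / 4) *
           expR (- (n%:R * spectral_gap mu p * t ^+ 2) /
                 (128 * pi ^- 2 * (2 - spectral_gap mu p / 2) +
                  1024 * pi ^- 3 * t)))%:E)%E)
    & (forall n : nat, (0 < n)%N ->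
         ('E_Pr [(fun w => frobenius_norm (Hmx U n w - dmx_of mu *m mx_of p) ^+ 2)%R]
          <= (ratio_norm nu mu *
              ((4 - spectral_gap mu p) / (n%:R * spectral_gap mu p)))%:E)%E)].
Proof.
split; last first.
- by case=> // n _; exact: frobenius_mean_sqr.
- case=> // n t _ t0.
  apply: (le_trans (op_norm_tail card_ge2 p_transition p_irreducible mu_distribution
    p_reversible nu_distribution U_chain n t t0)).
  have eta0 : 0 < spectral_gap mu p by exact: spectral_gap_gt0.
  have eta2 : spectral_gap mu p <= 2 by exact: spectral_gap_le2.
  set eta := spectral_gap mu p in eta0 eta2 *; set N : R := n.+1%:R.
  have N0 : 0 < N by rewrite ltr0n.
  have pi_lt4 : pi < 4 :> R by have := pihalf_lt2 R; lra.
  have pi_gt0 := pi_gt0 R.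
  rewrite lee_fin ler_pM ?expR_ge0//.
  + by rewrite mulr_ge0 ?bigmax_ge_id.
  (* The dimension factor is at least 1, because [pi < 4] makes its exponent positive. *)
  + rewrite ler_peMr ?mulr_ge0 ?bigmax_ge_id// -[leLHS](powRr0 #|Omega|%:R).
    apply: ler_powR; first by rewrite ler1n (leq_trans _ card_ge2).
    by rewrite subr_ge0; lra.
  + rewrite ler_expR mulNr lerN2.
    (* Here [8 = 128 / 16] and [16 = 1024 / 64], from [pi < 4], and [2 - eta / 2 >= 1] from
       [eta <= 2]. *)
    have den : 8 + 16 * t <= 128 * pi ^- 2 * (2 - eta / 2) + 1024 * pi ^- 3 * t.
      have pi2 : 16^-1 <= pi ^- 2 :> R.
        by rewrite lef_pV2 ?posrE ?exprn_gt0// expr2; nra.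
      have pi3 : 64^-1 <= pi ^- 3 :> R.
        rewrite lef_pV2 ?posrE ?exprn_gt0// exprS expr2; have : pi * pi <= 16 :> R by nra.
        by nra.
      apply: lerD; last by rewrite ler_pM2r//; lra.
      have -> : 8 = 128 * 16^-1 * 1 :> R by field.
      by apply: ler_pM => //; lra.
    have -> : N * (eta / 2 * t ^+ 2 / (4 + 8 * t)) = N * eta * t ^+ 2 / (8 + 16 * t).
      by field; rewrite !gt_eqF//; lra.
    apply: ler_wpM2l; first by rewrite mulr_ge0 ?sqr_ge0// mulr_ge0// ltW.
    move: (_ + 1024 * _ * t) den => D den.
    have den0 : 0 < 8 + 16 * t by lra.
    have D0 : 0 < D by exact: lt_le_trans den.
    by rewrite lef_pV2.
split.
- split; first exact: P2_transition.
    exact: pair_law_distribution.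
  exact: P2_reversible.
- by move=> n w _; rewrite /Hmx linearZ linear_sum /=; under eq_bigr do rewrite F2_sym.
- exact: (Hmx_cvg card_ge2 p_transition p_irreducible mu_distribution
    p_reversible U_chain).
Qed.
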